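(* Let $1\le p<2$ and $\varepsilon\le n^{-\frac12-\delta}$ with $\delta>0$. There exists a family $\mathcal{F}$ of convex functions on the $n$-dimensional unit $L^p$-ball $B_p(0,1)=\{x\in\mathbb{R}^n:\|x\|_p\le1\}$ that are Lipschitz-continuous in the $L^p$ norm with Lipschitz constant $1$, parametrized by the product of a finite set and a box of some $\mathbb{R}^N$, such that for any local oracle for $\mathcal{F}$, both the distributional and the high-probability oracle complexity of finding an $\varepsilon$-minimum under the uniform distribution (of the parameter) are $\Omega\left(n\log\frac1\varepsilon\right)$. For algorithms with error probability at most $P_e$, the distributional complexity is $\Omega\left((1-P_e)\,n\log\frac1\varepsilon\right)$ and the high-probability complexity is $\Omega\left(n\log\frac1\varepsilon\right)$.
   Context: The family may depend on $n,\varepsilon,p$. $\log$ is the binary logarithm. For $f:X\to\mathbb{R}$ with $f^*=\min_X f$, an $\varepsilon$-minimum is a point $x\in X$ with $f(x)<f^*+\varepsilon$. An oracle $\mathcal{O}$ for a family $\mathcal{F}$ of functions on $X$ returns for an instance $f\in\mathcal{F}$ and a query $x\in X$ an answer $\mathcal{O}_f(x)$ (from an arbitrary answer set). It is local if $\mathcal{O}_{f_1}(x)=\mathcal{O}_{f_2}(x)$ whenever $f_1,f_2\in\mathcal{F}$ are equal in a neighborhood of $x$. An algorithm knows $\mathcal{F}$ and the instance distribution but accesses the instance only by adaptive oracle queries; it stops and outputs a point of $X$. $T$ denotes its number of queries. The error probability is at most $P_e$ if the output is an $\varepsilon$-minimum with probability at least $1-P_e$ (over the random instance and any private randomness); $P_e=0$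 if no error is mentioned. The asymptotic statements mean: there is a constant $c>0$ (depending at most on $\delta$ and $p$) such that every algorithm with error probability at most $P_e$ satisfies $\mathbb{E}[T]\ge c(1-P_e)n\log\frac1\varepsilon$ (distributional) and $\mathbb{P}[T\ge c\,n\log\frac1\varepsilon]\ge1-P_e-o(1)$ (high-probability), asymptotically as $n\to\infty$ within the stated range of $\varepsilon$, with $p$, $\delta$ and $P_e\in[0,1)$ fixed. *)

(* Defs.v *)
From HB Require Import structures.
From mathcomp Require Import all_boot all_order all_algebra.
From mathcomp Require Import all_classical all_reals all_analysis.

Set Implicit Arguments.
Unset Strict Implicit.
Unset Printing Implicit Defensive.

Import Order.TTheory GRing.Theory Num.Theory.
Import numFieldNormedType.Exports.

Local Open Scope classical_set_scope.
Local Open Scope ring_scope.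

Definition log2 (R : realType) (x : R) : R := ln x / ln 2.

Definition lp_norm (R : realType) (n : nat) (p : R) (x : 'rV[R]_n) : R :=
  (\sum_(i < n) `|x ord0 i| `^ p) `^ p^-1.

Definition lp_ball (R : realType) (n : nat) (p : R) : set 'rV[R]_n :=
  [set x | lp_norm p x <= 1].
Arguments lp_ball {R} n p.

(* Throughout, a function on the ball is represented by a function on R^n of
   which only the values on the ball matter. *)

Definition lp_lipschitz1 (R : realType) (n : nat) (p : R)
    (f : 'rV[R]_n -> R) : Prop :=
  {in lp_ball n p &, forall x y, `|f x - f y| <= lp_norm p (x - y)}.

(* The infimum is attained for the functions considered: they are continuous
   on the compact ball. *)
Definition eps_minimum (R : realType) (n : nat) (p eps : R)
    (f : 'rV[R]_n -> R) (x : lp_ball n p) : Prop :=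
  f (val x) < inf (f @` lp_ball n p) + eps.

HB.instance Definition _ (m : nat) := isPointed.Build 'I_m.+1 ord0.

HB.instance Definition _ (m : nat) :=
  @isMeasurable.Build default_measure_display 'I_m.+1 discrete_measurable
    discrete_measurable0 discrete_measurableC discrete_measurableU.

Section uniform_ord.
Variables (R : realType) (m : nat).

Definition uniform_ord : set 'I_m.+1 -> \bar R :=
  mscale (m.+1%:R^-1)%:nng (msum (fun k => \d_(inord k : 'I_m.+1)) m.+1).

HB.instance Definition _ := Measure.on uniform_ord.

Let uniform_ord_setT : uniform_ord setT = 1%E.
Proof.
rewrite /uniform_ord /mscale /= /msum (eq_bigr (fun=> 1%E)); last first.
  by move=> k _; exact: diracT.
by rewrite sumEFin sumr_const card_ord -EFinM mulVf.
Qed.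

HB.instance Definition _ :=
  Measure_isProbability.Build _ _ _ uniform_ord uniform_ord_setT.
End uniform_ord.
Arguments uniform_ord : clear implicits.

Record side (R : realType) :=
  Side { lo : R; hi : R; lo_lt_hi : lo < hi }.

(* The box of R^N with N := size l, the i-th coordinate ranging over the i-th
   side of l. *)
Definition box (R : realType) (l : seq (side R)) : set ((size l).-tuple R) :=
  [set u | forall i : 'I_(size l),
    tnth u i \in `[lo (tnth (in_tuple l) i), hi (tnth (in_tuple l) i)]].

Section tuple_cons.
Variables (R : realType) (N : nat).

Definition tuple_cons (z : measurableTypeR R * N.-tuple R) : N.+1.-tuple R :=
  [tuple of (z.1 : R) :: z.2].

Let measurable_tuple_cons : measurable_fun setT tuple_cons.
Proof.
apply: (@measurable_cons _ _ _ R (fun z => z.1 : R)) => //.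
exact: (@measurable_fst _ _ (measurableTypeR R)).
Qed.

HB.instance Definition _ := isMeasurableFun.Build _ _ _ _
  tuple_cons measurable_tuple_cons.
End tuple_cons.
Arguments tuple_cons {R N}.

(* The product of the uniform distributions on the sides. *)
Fixpoint uniform_box (R : realType) (l : seq (side R)) :
    probability ((size l).-tuple R) R :=
  match l return probability ((size l).-tuple R) R with
  | [::] => dirac ([tuple] : 0.-tuple R)
  | s :: l' =>
      distribution (uniform_prob (lo_lt_hi s) \x uniform_box l')%E tuple_cons
  end.

(* Families of convex functions on the unit ball that are 1-Lipschitz in the
   L^p norm, parametrized by the product of the finite set 'I_(fam_card).+1 and
   a box.  Measurability in the parameter makes sense of the probability that
   a point is an eps-minimum. *)
Record convex_family (R : realType) (n : nat) (p : R) := ConvexFamily {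
  fam_card : nat;
  fam_sides : seq (side R);
  fam_fun : 'I_fam_card.+1 -> (size fam_sides).-tuple R -> 'rV[R]_n -> R;
  fam_convex : forall s u, box u -> convex_function (lp_ball n p) (fam_fun s u);
  fam_lipschitz : forall s u, box u -> lp_lipschitz1 p (fam_fun s u);
  fam_measurable : forall s x, lp_ball n p x ->
    measurable_fun (@box R fam_sides) (fun u => fam_fun s u x) }.
Arguments fam_fun {R n p}.

Definition fam_instances (R : realType) (n : nat) (p : R) (F : convex_family n p) :
    set ('rV[R]_n -> R) :=
  [set f | exists s u, box u /\ f = fam_fun F s u].

(* O f x is the answer to the query x on the instance f; its values on
   functions outside of the family are irrelevant. *)
Definition oracle (R : realType) (n : nat) (p : R) (A : Type) : Type :=
  ('rV[R]_n -> R) -> lp_ball n p -> A.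

(* Neighborhoods are relative to the ball, so the answers of a local oracle
   depend only on the restrictions of the instances to the ball. *)
Definition local_oracle (R : realType) (n : nat) (p : R) (F : convex_family n p)
    (A : Type) (O : oracle n p A) : Prop :=
  forall f1 f2 (x : lp_ball n p), fam_instances F f1 -> fam_instances F f2 ->
    (\forall y \near within (lp_ball n p) (nbhs (val x)), f1 y = f2 y) ->
    O f1 x = O f2 x.

Variant action (X : Type) := Query of X | Output of X.

Definition is_query (X : Type) (a : action X) : bool :=
  if a is Query _ then true else false.

Definition point_of (X : Type) (a : action X) : X :=
  match a with Query x => x | Output x => x end.

(* The next action as a function of the private randomness in Omega and of the
   answers received so far, oldest first. *)
Definition algorithm (R : realType) (n : nat) (p : R) (A Omega : Type) : Type :=
  Omega -> seq A -> action (lp_ball n p).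

Section run.
Variables (R : realType) (n : nat) (p : R) (A : Type).
Variables (next : seq A -> action (lp_ball n p)) (answer : lp_ball n p -> A).

(* The answers received after t steps; constant once the algorithm stops. *)
Fixpoint answers (t : nat) : seq A :=
  if t is t'.+1 then
    match next (answers t') with
    | Query x => rcons (answers t') (answer x)
    | Output _ => answers t'
    end
  else [::].

Definition action_at (t : nat) : action (lp_ball n p) := next (answers t).

(* As the action is frozen once the algorithm stops, this counts the queries;
   it is +oo if the algorithm never stops. *)
Definition num_queries : \bar R :=
  (\sum_(0 <= t <oo) ((is_query (action_at t))%:R : R)%:E)%E.

Definition outputs (x : lp_ball n p) : Prop := exists t, action_at t = Output x.
End run.

Section random_run.
Variables (R : realType) (n : nat) (p : R) (F : convex_family n p).
Variables (A : Type) (O : oracle n p A).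
Variables (d : measure_display) (Omega : measurableType d).
Variables (P : probability Omega R) (alg : algorithm n p A Omega).

Local Notation sample :=
  ('I_(fam_card F).+1 * (size (fam_sides F)).-tuple R * Omega)%type.

Let inst (z : sample) : 'rV[R]_n -> R := fam_fun F z.1.1 z.1.2.

(* Parameter uniform, independent of the private randomness. *)
Definition law : probability sample R :=
  ((uniform_ord R (fam_card F) \x uniform_box (fam_sides F)) \x P)%E.

Definition samples : set sample := [set z | box z.1.2].

Definition run_action (z : sample) (t : nat) : action (lp_ball n p) :=
  action_at (alg z.2) (O (inst z)) t.

Definition run_queries (z : sample) : \bar R :=
  num_queries (alg z.2) (O (inst z)).

(* The queries, the stopping time and the output are random variables. *)
Definition measurable_run : Prop :=
  forall t : nat,
    measurable_fun samples (fun z => is_query (run_action z t)) /\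
    forall i : 'I_n,
      measurable_fun samples (fun z => val (point_of (run_action z t)) ord0 i).

Definition expected_queries : \bar R := (\int[law]_(z in samples) run_queries z)%E.

Definition prob_queries_ge (r : R) : \bar R :=
  law (samples `&` [set z | r%:E <= run_queries z]%E).

Definition success_prob (eps : R) : \bar R :=
  law (samples `&`
    [set z | exists2 x, outputs (alg z.2) (O (inst z)) x
                      & eps_minimum eps (inst z) x]).
End random_run.

(* Main.v *)
(* The normalized rows of a Hadamard matrix of order m = 2^k in ]n/2, n] are
   1-Lipschitz coordinates y_i for the l_p norm, and every point of the cube
   [0, m^(-1/2)]^m is attained on the unit ball; this uses p <= 2.  An instance
   hides a letter among 16 m for each cell (r, i) with r < L and i < m; the
   letters of the cells (0, i), ..., (r, i) determine a centre c_(r,i), and the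
   instance is the maximum of 0 and of the functions
   4^(-r) (|y_i - c_(r,i)| - tol_r / 2).
   Its minimum is 0, and an eps-minimum is closer than tol_r to each c_(r,i).
   Around a query for which some cell of level r is off by at least tol_r, the
   levels beyond r are invisible, and among the cells of level r only those
   attaining the maximum of |y_i - c_(r,i)| are revealed.  Hence, giving away
   the letters of the preceding levels, the instances compatible with the
   answers so far form a product of sets of letters.  The product over the
   unknown cells of 4 m + (number of possible letters) / 4 bounds, up to a
   factor 8 per query, the number of instances solved for fixed private
   randomness.  Initially it is 2^(-L m) times the number of instances, so
   fewer than L m / 6 queries succeed only with exponentially small
   probability. *)

Require Import Defs.
From mathcomp Require Import all_boot all_order all_algebra.
From mathcomp Require Import all_classical all_reals all_analysis.
From mathcomp Require Import measurable_realfun.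
From mathcomp Require Import ring lra.

Set Implicit Arguments.
Unset Strict Implicit.
Unset Printing Implicit Defensive.

Import Order.TTheory GRing.Theory Num.Theory.
Import numFieldNormedType.Exports.

Local Open Scope ring_scope.

(** * Counting the instances solved by few queries *)

Section cylinders.
Variables (E Q : finType).
Implicit Types (J : E -> {set Q}) (s : {ffun E -> Q}).

(** [J e] is the set of letters still possible in the cell [e]; [cyl J] is thus the product of sets
    of letters left by the answers. *)
Definition cyl J : {set {ffun E -> Q}} :=
  [set s : {ffun E -> Q} | [forall e, s e \in J e]].

Definition restrict J e0 (S : {set Q}) : E -> {set Q} :=
  fun e => if e == e0 then S else J e.

Definition update s e0 a : {ffun E -> Q} :=
  [ffun e => if e == e0 then a else s e].

Lemma cylP J s : reflect (forall e, s e \in J e) (s \in cyl J).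
Proof. by rewrite inE; apply: forallP. Qed.

Lemma restrictE J e0 S : restrict J e0 S e0 = S.
Proof. by rewrite /restrict eqxx. Qed.

Lemma restrict_neq J e0 S e : e != e0 -> restrict J e0 S e = J e.
Proof. by rewrite /restrict => /negPf ->. Qed.

Lemma cyl_restrict J e0 (S : {set Q}) s : S \subset J e0 ->
  (s \in cyl (restrict J e0 S)) = (s \in cyl J) && (s e0 \in S).
Proof.
move=> /fintype.subsetP SJ; apply/cylP/andP => [sS|[/cylP sJ s0] e]; last first.
  by have [->|ne] := eqVneq e e0; rewrite ?restrictE ?restrict_neq.
have s0 : s e0 \in S by have := sS e0; rewrite restrictE.
split=> //; apply/cylP => e; have [->|ne] := eqVneq e e0; first exact: SJ.
by have := sS e; rewrite restrict_neq.
Qed.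

Lemma card_cyl_le1 J : (forall e, #|J e| <= 1)%N -> (#|cyl J| <= 1)%N.
Proof.
move=> J1; apply/card_le1_eqP => s s' /cylP sJ /cylP sJ'.
by apply/ffunP => e; apply: (card_le1_eqP (J1 e)).
Qed.

Lemma card_cyl_split J e0 a (X : {set {ffun E -> Q}}) : a \in J e0 ->
  #|X :&: cyl J| = (#|X :&: cyl (restrict J e0 [set a])|
                    + #|X :&: cyl (restrict J e0 (J e0 :\ a))|)%N.
Proof.
move=> aJ; rewrite -(cardsID [set s : {ffun E -> Q} | s e0 == a]).
congr (_ + _)%N; apply: eq_card => s; rewrite !inE.
  have := @cyl_restrict J e0 [set a] s; rewrite finset.sub1set => /(_ aJ).
  by rewrite !inE => ->; rewrite -andbA.
have := @cyl_restrict J e0 (J e0 :\ a) s; rewrite finset.subsetDl => /(_ isT).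
rewrite !inE => ->; case: (s e0 == a) => /=; rewrite ?andbF ?andbT //=.
case: (s \in X) => //=; apply/idP/andP => [sJ|[]//].
by split=> //; exact: (forallP sJ).
Qed.

Lemma card_cyl_sum J e0 (X : {set {ffun E -> Q}}) :
  #|X :&: cyl J| = \sum_(a in J e0) #|X :&: cyl (restrict J e0 [set a])|.
Proof.
rewrite -sum1_card.
rewrite (partition_big (fun s : {ffun E -> Q} => s e0) (mem (J e0))) /=; last first.
  by move=> s /setIP[_ /cylP]; exact.
apply: eq_bigr => a aJ; rewrite -sum1_card; apply: eq_bigl => s.
by rewrite !finset.in_setI cyl_restrict ?finset.sub1set// inE andbA.
Qed.

End cylinders.

Section weights.
Variables (R : realFieldType) (E Q : finType).
Implicit Types (J : E -> {set Q}) (U : {set E}).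

(** [U] collects the unknown cells. The term [A] pays for giving away the letter of a cell, and
    [B * #|J e|] falls by [B] whenever a letter is ruled out. *)
Definition weight (A B : R) J U := \prod_(e in U) (A + B * #|J e|%:R).

Definition known J U := forall e, e \notin U -> (#|J e| <= 1)%N.

Lemma known_set1 J U e0 a : known J U -> known (restrict J e0 [set a]) (U :\ e0).
Proof.
move=> kJ e; have [->|ne] := eqVneq e e0; first by rewrite restrictE cards1.
by rewrite restrict_neq// !inE ne; exact: kJ.
Qed.

Lemma known_restrict J U e0 S : e0 \in U -> known J U -> known (restrict J e0 S) U.
Proof.
move=> e0U kJ e eU; rewrite restrict_neq ?kJ//.
by apply: contraNneq eU => ->.
Qed.

Lemma weight_restrict_out A B J U e0 S :
  weight A B (restrict J e0 S) (U :\ e0) = weight A B J (U :\ e0).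
Proof. by apply: eq_bigr => e; rewrite !inE => /andP[ne _]; rewrite restrict_neq. Qed.

Lemma weightD1 A B J U e0 : e0 \in U ->
  weight A B J U = (A + B * #|J e0|%:R) * weight A B J (U :\ e0).
Proof.
move=> e0U; rewrite /weight (bigD1 e0)//=; congr (_ * _).
by apply: eq_bigl => e; rewrite !inE andbC.
Qed.

Lemma weight_restrict A B J U e0 S : e0 \in U ->
  weight A B (restrict J e0 S) U = (A + B * #|S|%:R) * weight A B J (U :\ e0).
Proof. by move=> e0U; rewrite (@weightD1 _ _ _ _ e0)// restrictE weight_restrict_out. Qed.

Lemma weight_ge0 A B J U : 0 <= A -> 0 <= B -> 0 <= weight A B J U.
Proof. by move=> A0 B0; apply: prodr_ge0 => e _; rewrite addr_ge0 ?mulr_ge0. Qed.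

End weights.

(** * The cost of a single query *)

Section one_query.
Variables (R : realFieldType) (E Q : finType) (lev : E -> nat) (L m : nat).
Variables (A B c C : R) (delta : E -> {ffun E -> Q} -> R) (rho : nat -> R).
Variable X : {set {ffun E -> Q}}.
Implicit Types (J : E -> {set Q}) (U : {set E}) (s : {ffun E -> Q}).

Hypotheses (levL : forall e, (lev e < L)%N)
  (card_lev : forall r, (#|[set e | lev e == r]| <= m)%N)
  (A_gt0 : 0 < A) (B_gt0 : 0 < B)
  (* pays for ties at the maximum, which at most two letters per cell attain *)
  (A_large : (1 + 2 / A) ^+ m <= 2)
  (c_ge0 : 0 <= c) (C_ge1 : 1 <= C) (cC : c <= C) (c_leC : 2 * c <= C * B).

Hypothesis delta_dep : forall e s s',
  (forall e', (lev e' < lev e)%N -> s e' = s' e') -> s e = s' e ->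
  delta e s = delta e s'.
Hypothesis delta_ties : forall e s v,
  (#|[set a | delta e (update s e a) == v]| <= 2)%N.
Hypothesis delta_small : forall e s,
  #|[set a | delta e (update s e a) < rho (lev e)]|%:R <= A.

(* On such a cylinder all instances give the same answer: the maximum at level
   [r] is attained by known cells only. *)
Hypothesis homogeneous : forall J U r e0, known J U ->
  (forall e, (lev e < r)%N -> e \notin U) -> lev e0 = r -> e0 \notin U ->
  (forall s, s \in cyl J -> rho r <= delta e0 s /\
     forall e, lev e = r ->
       delta e s <= delta e0 s /\ (e \in U -> delta e s < delta e0 s)) ->
  #|X :&: cyl J|%:R <= c * weight A B J U.

Section one_level.
Variables (r : nat) (s0 : {ffun E -> Q}).

Let d e a := delta e (update s0 e a).

(** The levels below [r] are settled as in the reference instance [s0], so that at level [r] the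
    value [delta e s] depends on the letter [s e] alone. *)
Let low J U := forall e, (lev e < r)%N -> e \notin U /\ J e \subset [set s0 e].

Let lowE J U s e : low J U -> s \in cyl J -> lev e = r -> delta e s = d e (s e).
Proof.
move=> lJ /cylP sJ er; apply: delta_dep => [e' e'r|]; last by rewrite ffunE eqxx.
have ne : e' != e by apply: contraTneq e'r => ->; rewrite ltnn.
rewrite er in e'r; have [_ /fintype.subsetP /(_ _ (sJ e'))] := lJ e' e'r.
by rewrite inE ffunE (negPf ne) => /eqP.
Qed.

Let low_restrict J U (U' : {set E}) e0 (S : {set Q}) :
  low J U -> S \subset J e0 -> U' \subset U -> low (restrict J e0 S) U'.
Proof.
move=> lJ SJ UU e er; have [eU Je] := lJ e er; split.
  by apply: contra eU; exact: (fintype.subsetP UU).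
have [E0|ne] := eqVneq e e0; last by rewrite restrict_neq.
by rewrite E0 restrictE (fintype.subset_trans SJ)// -E0.
Qed.

Let tied J v e : {set Q} := [set a : Q in J e | (lev e == r) && (d e a == v)].

Let tied_le2 J v e : (#|tied J v e| <= 2)%N.
Proof.
apply: leq_trans (delta_ties e s0 v); apply: subset_leq_card.
by apply/fintype.subsetP => a; rewrite !inE => /and3P[].
Qed.

(** Induction on the number of letters of unknown cells that tie with the known cell [e0]. Either
    the tied [a1] is the letter of [e1], which makes [e1] known and leaves the factor 1 for it, or
    [a1] is ruled out. Once no tie is left, [homogeneous] applies. *)
Let tie_bound J U e0 v : known J U -> low J U -> lev e0 = r -> e0 \notin U ->
  rho r <= v ->
  (forall s, s \in cyl J -> d e0 (s e0) = v) ->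
  (forall e a, lev e = r -> a \in J e -> d e a <= v) ->
  #|X :&: cyl J|%:R
    <= c * \prod_(e in U) (A + B * #|J e|%:R + #|tied J v e|%:R).
Proof.
have [n] := ubnP (\sum_(e in U) #|tied J v e|)%N.
elim: n J U => // n IHn J U; rewrite ltnS => nU kJ lJ e0r e0U rv e0v leJ.
have [/existsP[e1 /andP[e1U /existsP[a1 a1t]]]|] :=
    boolP [exists e, (e \in U) && [exists a, a \in tied J v e]]; last first.
  move=> notie.
  have t0 e : e \in U -> tied J v e = finset.set0.
    move=> eU; apply/setP => a; rewrite [RHS]inE; apply/negP => aT.
    by move/existsP: notie; apply; exists e; rewrite eU; apply/existsP; exists a.
  apply: (@le_trans _ _ (c * weight A B J U)); last first.
    rewrite ler_wpM2l//; apply: ler_prod => e eU.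
    by rewrite t0// cards0 addr0 lexx andbT addr_ge0 ?mulr_ge0 // ltW.
  apply: (homogeneous kJ _ e0r e0U) => [e er|s sJ]; first by have [] := lJ e er.
  rewrite (lowE lJ sJ e0r) e0v//; split=> // e er.
  have se : s e \in J e by apply/cylP.
  rewrite (lowE lJ sJ er); split; first exact: leJ.
  move=> eU; rewrite lt_neqAle leJ// andbT; apply/negP => eqv.
  by have := t0 e eU => /setP/(_ (s e)); rewrite !inE se er eqxx eqv.
move: (a1t); rewrite inE => /and3P[a1J /eqP e1r /eqP a1v].
pose w J e := A + B * #|J e|%:R + #|tied J v e|%:R : R.
have wD1 J' : \prod_(e in U) w J' e = w J' e1 * \prod_(e in U :\ e1) w J' e.
  rewrite (bigD1 e1)//=; congr (_ * _).
  by apply: eq_bigl => e; rewrite !inE andbC.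
have wout S : \prod_(e in U :\ e1) w (restrict J e1 S) e
    = \prod_(e in U :\ e1) w J e.
  apply: eq_bigr => e; rewrite !inE => /andP[ne _].
  by rewrite /w /tied restrict_neq.
have tout S e : e != e1 -> tied (restrict J e1 S) v e = tied J v e.
  by move=> ne; rewrite /tied restrict_neq.
have sub1 : [set a1] \subset J e1 by rewrite finset.sub1set.
have subD : J e1 :\ a1 \subset J e1 by rewrite finset.subsetDl.
have tD : #|tied J v e1| = #|tied (restrict J e1 (J e1 :\ a1)) v e1|.+1.
  rewrite (cardsD1 a1) a1t add1n; congr _.+1; apply: eq_card => a.
  by rewrite !inE restrictE !inE !andbA.
have posw e : 0 <= w J e by rewrite !addr_ge0 ?mulr_ge0 // ltW.
have pos : 0 <= \prod_(e in U :\ e1) w J e by apply: prodr_ge0.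
have sumD1 J' : (\sum_(e in U) #|tied J' v e| =
   #|tied J' v e1| + \sum_(e in U :\ e1) #|tied J' v e|)%N.
  rewrite (bigD1 e1)//=; congr (_ + _)%N.
  by apply: eq_bigl => e; rewrite !inE andbC.
have sumout S : (\sum_(e in U :\ e1) #|tied (restrict J e1 S) v e| =
   \sum_(e in U :\ e1) #|tied J v e|)%N.
  by apply: eq_bigr => e; rewrite !inE => /andP[ne _]; rewrite tout.
have leS (S : {set Q}) : S \subset J e1 ->
    forall e a, lev e = r -> a \in restrict J e1 S e -> d e a <= v.
  move=> SJ e a er; have [->|ne] := eqVneq e e1.
    by rewrite restrictE => /(fintype.subsetP SJ); exact: leJ.
  by rewrite restrict_neq//; exact: leJ.
have vS (S : {set Q}) : S \subset J e1 ->
    forall s, s \in cyl (restrict J e1 S) -> d e0 (s e0) = v.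
  by move=> SJ s; rewrite cyl_restrict// => /andP[/e0v].
rewrite (card_cyl_split _ a1J) natrD.
have H1 : #|X :&: cyl (restrict J e1 [set a1])|%:R
    <= c * \prod_(e in U :\ e1) w J e.
  rewrite -(wout [set a1]); apply: IHn => //.
  - by rewrite sumout; apply: leq_trans nU; rewrite sumD1 tD addSn ltnS leq_addl.
  - exact: known_set1.
  - by apply: (low_restrict lJ sub1); rewrite finset.subsetDl.
  - by rewrite !inE (negPf e0U) andbF.
  - exact: vS.
  - exact: leS.
have H2 : #|X :&: cyl (restrict J e1 (J e1 :\ a1))|%:R
    <= c * \prod_(e in U) w (restrict J e1 (J e1 :\ a1)) e.
  apply: IHn => //.
  - by rewrite sumD1 sumout; apply: leq_trans nU; rewrite sumD1 tD addSn.
  - exact: known_restrict.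
  - exact: (low_restrict lJ subD).
  - exact: vS.
  - exact: leS.
apply: le_trans (lerD H1 H2) _; rewrite -mulrDr ler_wpM2l//.
rewrite wD1 wout [leRHS]wD1 -{1}[\prod_(e in _) _]mul1r -mulrDl ler_wpM2r//.
rewrite /w tD restrictE (cardsD1 a1 (J e1)) a1J add1n !mulrS mulrDr mulr1.
by move: (ltW B_gt0) => ?; lra.
Qed.

(** At most two letters per cell tie and at most [m] cells have level [r], so the product in
    [tie_bound] exceeds the weight by a factor of at most [(1 + 2 / A) ^+ m]. *)
Let tie_bound2 J U e0 v : known J U -> low J U -> lev e0 = r -> e0 \notin U ->
  rho r <= v ->
  (forall s, s \in cyl J -> d e0 (s e0) = v) ->
  (forall e a, lev e = r -> a \in J e -> d e a <= v) ->
  #|X :&: cyl J|%:R <= 2 * c * weight A B J U.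
Proof.
move=> kJ lJ e0r e0U rv e0v leJ.
apply: le_trans (tie_bound kJ lJ e0r e0U rv e0v leJ) _.
rewrite (mulrC 2) -mulrA ler_wpM2l//.
have A0 := ltW A_gt0; have B0 := ltW B_gt0.
have w0 : 0 <= weight A B J U by exact: weight_ge0.
apply: (@le_trans _ _ (\prod_(e in U) ((A + B * #|J e|%:R)
                * (if lev e == r then 1 + 2 / A else 1)))).
  apply: ler_prod => e eU; rewrite !addr_ge0 ?mulr_ge0//=.
  have := tied_le2 J v e; case: ifPn => [_ t2|/negPf er _]; last first.
    rewrite mulr1 (_ : tied J v e = finset.set0) ?cards0 ?addr0//.
    by apply/setP => a; rewrite !inE er andbF.
  rewrite [leRHS]mulrDr mulr1 lerD2l.
  apply: (@le_trans _ _ 2); first by rewrite ler_nat.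
  rewrite mulrA ler_pdivlMr// [leRHS]mulrC ler_wpM2l// ler_wpDr//.
  by rewrite mulr_ge0.
rewrite big_split/= [leRHS]mulrC ler_wpM2l//.
rewrite -big_mkcondr/= -[X in _ <= X]mul1r.
apply: le_trans; last by rewrite mul1r; exact: A_large.
have -> : \prod_(e in U | lev e == r) (1 + 2 / A)
    = (1 + 2 / A) ^+ #|[set e in U | lev e == r]|.
  by rewrite -prodr_const; apply: eq_bigl => e; rewrite inE.
apply: ler_weXn2l; first by rewrite lerDl divr_ge0.
apply: leq_trans (card_lev r); apply: subset_leq_card.
by apply/fintype.subsetP => e; rewrite !inE => /andP[].
Qed.

Hypothesis next_level : forall J U, known J U ->
  (forall e, (lev e < r.+1)%N -> e \notin U) ->
  #|X :&: cyl J|%:R <= C * weight A B J U.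

(** If all possible letters at level [r] have values below [rho r], each cell of that level has at
    most [A] of them. Summing over them is paid by the term [A] of the weight, so the whole level
    can be given away. *)
Let reveal_level J U : known J U -> low J U ->
  (forall e a, lev e = r -> a \in J e -> d e a < rho r) ->
  #|X :&: cyl J|%:R <= C * weight A B J U.
Proof.
have [n] := ubnP #|U|; elim: n J U => // n IHn J U; rewrite ltnS => nU kJ lJ dJ.
have A0 := ltW A_gt0; have B0 := ltW B_gt0; have C0 := le_trans ler01 C_ge1.
have [/existsP[e1 /andP[e1U /eqP e1r]]|noU] :=
    boolP [exists e, (e \in U) && (lev e == r)]; last first.
  apply: next_level => // e; rewrite ltnS leq_eqVlt => /orP[er|er].
    by apply: contra noU => eU; apply/existsP; exists e; rewrite eU.
  by have [] := lJ e er.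
rewrite (@card_cyl_sum _ _ _ e1) natr_sum (weightD1 _ _ _ e1U).
have w0 : 0 <= weight A B J (U :\ e1) by exact: weight_ge0.
apply: (@le_trans _ _ (\sum_(a in J e1) C * weight A B J (U :\ e1))).
  apply: ler_sum => a aJ; rewrite -(weight_restrict_out _ _ _ _ _ [set a]).
  have sub1 : [set a] \subset J e1 by rewrite finset.sub1set.
  apply: IHn.
  - by move: nU; rewrite (cardsD1 e1) e1U.
  - exact: known_set1.
  - by apply: (low_restrict lJ sub1); rewrite finset.subsetDl.
  - move=> e b er; have [->|ne] := eqVneq e e1.
      by rewrite restrictE => /(fintype.subsetP sub1); exact: dJ.
    by rewrite restrict_neq//; exact: dJ.
rewrite sumr_const -[leLHS]mulr_natl mulrCA ler_wpM2l// ler_wpM2r//.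
apply: ler_wpDr; first by rewrite mulr_ge0.
apply: le_trans (delta_small e1 s0); rewrite ler_nat; apply: subset_leq_card.
by apply/fintype.subsetP => a aJ; rewrite inE e1r; exact: dJ.
Qed.

(** Induction on the number of possible letters of unknown cells, looking at a letter of level [r]
    with the largest [d]. Either it is below [rho r] and the level is given away, or only known
    cells attain the maximum and [homogeneous] applies, or an unknown cell [e1] attains it at [a1]
    and one branches on whether [a1] is its letter. *)
Let level_bound J U : known J U -> low J U ->
  #|X :&: cyl J|%:R <= C * weight A B J U.
Proof.
have [n] := ubnP (\sum_(e in U) #|J e|)%N.
elim: n J U => // n IHn J U; rewrite ltnS => nU kJ lJ.
have A0 := ltW A_gt0; have B0 := ltW B_gt0; have C0 := le_trans ler01 C_ge1.
pose ok (x : E * Q) := (lev x.1 == r) && (x.2 \in J x.1).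
have [/existsP[x0 x0ok]|] := boolP [exists x, ok x]; last first.
  move=> nok; apply: reveal_level => // e a er aJ.
  by case/existsP: nok; exists (e, a); rewrite /ok er eqxx.
pose dd (x : E * Q) := d x.1 x.2.
have [xm /andP[/eqP xmr xmJ] xmax] := arg_maxP dd x0ok.
have [ltrho|gerho] := ltP (dd xm) (rho r).
  apply: reveal_level => // e a er aJ; apply: le_lt_trans ltrho.
  by apply: (xmax (e, a)); rewrite /ok er eqxx.
have [/existsP[y /and3P[/andP[/eqP yr yJ] yU /eqP ym]]|nomax] :=
    boolP [exists y, [&& ok y, y.1 \in U & dd y == dd xm]]; last first.
  have xmU : xm.1 \notin U.
    apply: contra nomax => xU; apply/existsP; exists xm.
    by rewrite /ok xmr eqxx xmJ xU eqxx.
  apply: (@le_trans _ _ (c * weight A B J U)); last first.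
    by rewrite ler_wpM2r// weight_ge0.
  apply: (homogeneous kJ _ xmr xmU) => [e er|s sJ]; first by have [] := lJ e er.
  have sJe e : s e \in J e by apply/cylP.
  have -> : delta xm.1 s = dd xm.
    rewrite (lowE lJ sJ xmr) /dd; congr (d _ _).
    exact: (card_le1_eqP (kJ _ xmU)).
  split=> // e er; rewrite (lowE lJ sJ er).
  have le_m : d e (s e) <= dd xm by apply: (xmax (e, s e)); rewrite /ok er eqxx sJe.
  split=> // eU; rewrite lt_neqAle le_m andbT; apply: contra nomax => eqm.
  by apply/existsP; exists (e, s e); rewrite /ok er eqxx sJe eU.
case: y => [e1 a1] /= in yr yJ yU ym *.
have sub1 : [set a1] \subset J e1 by rewrite finset.sub1set.
have subD : J e1 :\ a1 \subset J e1 by rewrite finset.subsetDl.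
have w0 : 0 <= weight A B J (U :\ e1) by exact: weight_ge0.
have H1 : #|X :&: cyl (restrict J e1 [set a1])|%:R
    <= 2 * c * weight A B J (U :\ e1).
  rewrite -(weight_restrict_out _ _ _ _ _ [set a1]).
  apply: (@tie_bound2 _ _ e1 (dd xm)) => //.
  - exact: known_set1.
  - by apply: (low_restrict lJ sub1); rewrite finset.subsetDl.
  - by rewrite !inE eqxx.
  - by move=> s; rewrite cyl_restrict// inE => /andP[_ /eqP ->]; rewrite -ym.
  - move=> e a er aR; apply: (xmax (e, a)); rewrite /ok er eqxx/=.
    have [E0|ne] := eqVneq e e1; last by move: aR; rewrite restrict_neq.
    by move: aR; rewrite E0 restrictE => /(fintype.subsetP sub1).
have H2 : #|X :&: cyl (restrict J e1 (J e1 :\ a1))|%:R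
    <= C * ((A + B * #|J e1 :\ a1|%:R) * weight A B J (U :\ e1)).
  rewrite -(weight_restrict _ _ _ _ yU); apply: IHn.
  - apply: leq_trans nU; rewrite (bigD1 e1)//= [ltnRHS](bigD1 e1)//= restrictE.
    rewrite (cardsD1 a1 (J e1)) yJ -addnA add1n ltnS leq_add2l leq_eqVlt.
    by apply/orP; left; apply/eqP/eq_bigr => e /andP[_ ne]; rewrite restrict_neq.
  - exact: known_restrict.
  - exact: (low_restrict lJ subD).
(* The branch where [a1] is the letter costs [2 * c]; ruling out [a1] in the other branch frees
   [C * B], which is enough by [c_leC]. *)
rewrite (card_cyl_split _ yJ) natrD; apply: le_trans (lerD H1 H2) _.
rewrite (weightD1 _ _ _ yU) [C * (_ * _)]mulrA -mulrDl [leRHS]mulrA ler_wpM2r//.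
rewrite (cardsD1 a1 (J e1)) yJ natrD !mulrDr mulr1.
by move: c_leC; lra.
Qed.

Lemma count_level J U : known J U -> s0 \in cyl J ->
  (forall e, (lev e < r)%N -> e \notin U) ->
  #|X :&: cyl J|%:R <= C * weight A B J U.
Proof.
move=> kJ /cylP s0J Ur; apply: level_bound => // e er; split; first exact: Ur.
apply/fintype.subsetP => a aJ; rewrite inE; apply/eqP.
exact: (card_le1_eqP (kJ _ (Ur e er))).
Qed.
End one_level.

(** Induction on the number [n] of levels that may be unknown, [r] being the first of them. At
    [r = L] everything is known and the cylinder has at most one element. *)
Lemma count_query J U : known J U -> #|X :&: cyl J|%:R <= C * weight A B J U.
Proof.
move=> kJ.
suff H : forall n r J U, (r + n)%N = L -> known J U ->
    (forall e, (lev e < r)%N -> e \notin U) ->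
    #|X :&: cyl J|%:R <= C * weight A B J U.
  by apply: (H L 0%N).
have A0 := ltW A_gt0; have B0 := ltW B_gt0; have C0 := le_trans ler01 C_ge1.
elim=> [|n IHn] r J' U' rL kJ' Ur.
  have U0 e : e \notin U' by apply: Ur; rewrite -(addn0 r) rL.
  have -> : weight A B J' U' = 1.
    by rewrite /weight big1// => e; rewrite (negPf (U0 e)).
  rewrite mulr1; apply: le_trans C_ge1; rewrite lern1.
  apply: leq_trans (card_cyl_le1 (fun e => kJ' e (U0 e))).
  by rewrite subset_leq_card// finset.subsetIr.
have [->|[s0 s0J]] := set_0Vmem (cyl J').
  by rewrite finset.setI0 cards0 mulr_ge0// weight_ge0.
apply: (@count_level r s0) => // J2 U2; apply: IHn.
by rewrite addSnnS.
Qed.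
End one_query.

(** * Induction over the queries of an algorithm *)

Section solved_instances.
Variables (R : realFieldType) (E Q : finType) (lev : E -> nat) (L m : nat).
Variables (Pt Ans : Type) (next : seq Ans -> action Pt).
Variables (ans : {ffun E -> Q} -> Pt -> Ans) (good : {ffun E -> Q} -> Pt -> Prop).
Variables (A B : R) (delta : Pt -> E -> {ffun E -> Q} -> R) (rho : nat -> R).
Implicit Types (J : E -> {set Q}) (U : {set E}) (s : {ffun E -> Q}).

(** [k] bounds the number of further queries after the answers [l]; a run that would exceed it
    counts as a failure. *)
Fixpoint solves (k : nat) (l : seq Ans) s : Prop :=
  match next l with
  | Output x => good s x
  | Query x => if k is k'.+1 then solves k' (rcons l (ans s x)) s else False
  end.

Definition solved k l : {set {ffun E -> Q}} := [set s | `[< solves k l s >]].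

Hypotheses (levL : forall e, (lev e < L)%N)
  (card_lev : forall r, (#|[set e | lev e == r]| <= m)%N)
  (A_gt0 : 0 < A) (B_gt0 : 0 < B) (B_le2 : B <= 2)
  (A_large : (1 + 2 / A) ^+ m <= 2).

Hypothesis delta_dep : forall x e s s',
  (forall e', (lev e' < lev e)%N -> s e' = s' e') -> s e = s' e ->
  delta x e s = delta x e s'.
Hypothesis delta_ties : forall x e s v,
  (#|[set a | delta x e (update s e a) == v]| <= 2)%N.
Hypothesis delta_small : forall x e s,
  #|[set a | delta x e (update s e a) < rho (lev e)]|%:R <= A.

Hypothesis same_answer : forall x s s' e0,
  (forall e, (lev e < lev e0)%N -> s e = s' e) -> s e0 = s' e0 ->
  rho (lev e0) <= delta x e0 s ->
  (forall e, lev e = lev e0 ->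
     [/\ delta x e s <= delta x e0 s, delta x e s' <= delta x e0 s' &
      s e = s' e \/
      (delta x e s < delta x e0 s /\ delta x e s' < delta x e0 s')]) ->
  ans s x = ans s' x.
Hypothesis good_small : forall x s e, good s x -> delta x e s < rho (lev e).

(** Each query costs a factor [2 / B]: the 2 comes from the ties at the maximum, the [B] from ruling
    out a letter that attains it. *)
Theorem count_solved k l J U : known J U ->
  #|solved k l :&: cyl J|%:R <= (2 / B) ^+ k * weight A B J U.
Proof.
have B2 : 1 <= 2 / B by rewrite ler_pdivlMr// mul1r.
have pow1 j : 1 <= (2 / B) ^+ j by rewrite exprn_ege1.
elim: k l J U => [|k IHk] l J U kJ.
  case nl: (next l) => [x|x].
    rewrite (_ : solved 0 l = finset.set0) ?finset.set0I ?cards0.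
      by rewrite mulr_ge0 ?exprn_ge0 ?weight_ge0// ?(le_trans ler01 B2) ?ltW.
    apply/setP => s; rewrite !inE; apply/negP => /asboolP /=; by rewrite nl.
  (* An output gains nothing: [c = 0] is possible because a homogeneous cylinder has [delta x e0 s]
     at least [rho], which excludes a good output. *)
  rewrite expr0; apply: (@count_query _ _ _ lev L m A B 0 1 (delta x) rho) => //;
    rewrite ?mulr0 ?mul1r ?ltW//; first exact: delta_dep.
  move=> J' U' r e0 kJ' _ e0r e0U H; rewrite mul0r.
  rewrite (_ : _ :&: _ = finset.set0) ?cards0//; apply/setP => s.
  rewrite !inE; apply/negP => /andP[/asboolP]/=; rewrite nl => gs.
  move=> sJ; have [|+ _] := H s; first by rewrite inE.
  by rewrite leNgt -e0r good_small.
case nl: (next l) => [x|x]; last first.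
  apply: (@le_trans _ _ (1 * weight A B J U)); last first.
    by rewrite ler_wpM2r// weight_ge0 ?ltW.
  apply: (@count_query _ _ _ lev L m A B 0 1 (delta x) rho) => //;
    rewrite ?mulr0 ?mul1r ?ltW//; first exact: delta_dep.
  move=> J' U' r e0 kJ' _ e0r e0U H; rewrite mul0r.
  rewrite (_ : _ :&: _ = finset.set0) ?cards0//; apply/setP => s.
  rewrite !inE; apply/negP => /andP[/asboolP]/=; rewrite nl => gs.
  move=> sJ; have [|+ _] := H s; first by rewrite inE.
  by rewrite leNgt -e0r good_small.
apply: (@count_query _ _ _ lev L m A B ((2 / B) ^+ k) _ (delta x) rho) => //.
- exact: le_trans ler01 (pow1 k).
- by rewrite exprS ler_peMl// (le_trans ler01 (pow1 k)).
- by rewrite exprS mulrAC divfK// gt_eqF.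
- exact: delta_dep.
move=> J' U' r e0 kJ' Ur e0r e0U H.
have [->|[s0 s0J]] := set_0Vmem (cyl J').
  rewrite finset.setI0 cards0 mulr_ge0 ?weight_ge0 ?ltW//.
  exact: lt_le_trans ltr01 (pow1 k).
(* All instances of a homogeneous cylinder answer like [s0], so their runs continue with the same
   list of answers. *)
apply: le_trans (IHk (rcons l (ans s0 x)) J' U' kJ').
rewrite ler_nat; apply: subset_leq_card; apply/fintype.subsetP => s.
rewrite !finset.in_setI => /andP[+ sJ]; rewrite sJ andbT.
rewrite !inE => /asboolP/=; rewrite nl => sol; apply/asboolP.
rewrite (_ : ans s0 x = ans s x)//.
have eqJ e : e \notin U' -> s0 e = s e.
  by move=> eU; apply: (card_le1_eqP (kJ' _ eU)); apply/cylP.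
apply: (same_answer (e0 := e0)); rewrite ?e0r.
- by move=> e er; apply: eqJ; exact: Ur.
- exact: eqJ.
- by have [] := H _ s0J.
move=> e er; have [_ /(_ _ er)[le0 lt0]] := H _ s0J.
have [_ /(_ _ er)[le1 lt1]] := H _ sJ; split=> //.
by have [eU|/eqJ] := boolP (e \in U'); [right; rewrite lt0 ?lt1|left].
Qed.
End solved_instances.

(** * Runs are frozen after their output *)

Section runs.
Variables (R : realType) (n : nat) (p : R) (A : Type).
Variables (next : seq A -> action (lp_ball n p)) (answer : lp_ball n p -> A).

Lemma answers_frozen t j x : action_at next answer t = Output x ->
  answers next answer (t + j) = answers next answer t.
Proof.
move=> tx; elim: j => [|j IHj]; first by rewrite addn0.
by rewrite addnS /= IHj; move: tx; rewrite /action_at => ->.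
Qed.

Lemma action_frozen t j x : action_at next answer t = Output x ->
  action_at next answer (t + j) = Output x.
Proof. by move=> tx; rewrite /action_at (answers_frozen _ tx). Qed.

Lemma output_unique t t' x x' : action_at next answer t = Output x ->
  action_at next answer t' = Output x' -> x = x'.
Proof.
move=> tx tx'; have := action_frozen t' tx; have := action_frozen t tx'.
by rewrite addnC => -> [].
Qed.

Lemma queries_gt k : is_query (action_at next answer k) ->
  ((k.+1%:R : R)%:E <= num_queries next answer)%E.
Proof.
move=> qk; have q t : (t <= k)%N -> is_query (action_at next answer t).
  move=> tk; case E : (action_at next answer t) => [|x] //.
  by move: qk; rewrite -(subnKC tk) (action_frozen _ E).
apply: (@le_trans _ _ (\sum_(0 <= t < k.+1)
    ((is_query (action_at next answer t))%:R : R)%:E)%E); last first.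
  by apply: nneseries_lim_ge => i _ _; rewrite lee_fin.
rewrite big_mkord (eq_bigr (fun=> 1%E)) ?sumEFin ?sumr_const ?card_ord//.
by move=> i _; rewrite q// -ltnS.
Qed.
End runs.

(** The invariant is that [j = k - t] queries remain after [t] steps. An output before step [k] is
    already the one seen at step [k], by [output_unique]. *)
Lemma solves_output (R : realType) (n : nat) (p : R) (A : Type) (E Q : finType)
    (next : seq A -> action (lp_ball n p)) (ans : {ffun E -> Q} -> lp_ball n p -> A)
    (good : {ffun E -> Q} -> lp_ball n p -> Prop) s k x :
  action_at next (ans s) k = Output x -> good s x ->
  solves next ans good k [::] s.
Proof.
move=> kx gx; suff H j t : (t + j)%N = k ->
    solves next ans good j (answers next (ans s) t) s by exact: (H k 0%N).
elim: j t => [|j IHj] t tjk.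
  by move: kx; rewrite -tjk addn0 /action_at /= => ->.
rewrite /=; case E0 : (next (answers next (ans s) t)) => [y|y].
  by have := IHj t.+1; rewrite /= E0; apply; rewrite addSnnS.
by rewrite (output_unique E0 kx).
Qed.

(** * The Hadamard coordinates *)

Section hadamard.
Variable R : comNzRingType.

(** Sylvester's matrix: the sign is the parity of the number of ones common to the last [k] binary
    digits of [i] and [j]. *)
Fixpoint hadamard (k i j : nat) : R :=
  if k is k'.+1 then (-1) ^+ (odd i && odd j) * hadamard k' i./2 j./2 else 1.

Lemma hadamard_sqr k i j : hadamard k i j * hadamard k i j = 1.
Proof.
elim: k i j => [|k IHk] i j /=; first by rewrite mulr1.
by rewrite mulrACA IHk mulr1 -expr2 sqrr_sign.
Qed.

Lemma sum_double n (f : nat -> R) :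
  \sum_(j < n.*2) f j = \sum_(j < n) (f j.*2 + f j.*2.+1).
Proof.
elim: n => [|n IHn]; first by rewrite !big_ord0.
by rewrite doubleS !big_ord_recr /= IHn addrA.
Qed.

(** The columns [j.*2] and [j.*2.+1] are paired; together they carry the factor
    [1 + (-1) ^+ (odd i (+) odd i')], which vanishes when the last digits of [i] and [i'] differ. *)
Lemma hadamard_orthogonal k i i' : (i < 2 ^ k)%N -> (i' < 2 ^ k)%N ->
  \sum_(j < 2 ^ k) hadamard k i j * hadamard k i' j = (2 ^ k)%:R *+ (i == i').
Proof.
elim: k i i' => [|k IHk] i i'.
  by case: i i' => [|[]] [|[]]//; rewrite expn0 big_ord1 mulr1.
rewrite expnS mul2n => ik i'k.
rewrite (sum_double _ (fun j => hadamard k.+1 i j * hadamard k.+1 i' j)).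
have E (j : nat) : hadamard k.+1 i j.*2 * hadamard k.+1 i' j.*2 +
    hadamard k.+1 i j.*2.+1 * hadamard k.+1 i' j.*2.+1 =
    (1 + (-1) ^+ (odd i (+) odd i')) * (hadamard k i./2 j * hadamard k i'./2 j).
  rewrite /= odd_double doubleK uphalf_double !andbF !andbT expr0 !mul1r signr_addb.
  ring.
rewrite (eq_bigr _ (fun (j : 'I_(2 ^ k)) _ => E j)) -big_distrr/= IHk; last 2 first.
- by rewrite ltn_half_double.
- by rewrite ltn_half_double.
have -> : (i == i') = (odd i == odd i') && (i./2 == i'./2).
  apply/eqP/andP => [->|[/eqP oi /eqP hi]]; first by rewrite !eqxx.
  by rewrite -(odd_double_half i) -(odd_double_half i') oi hi.
case: (i./2 == i'./2); last by rewrite andbF mulr0n mulr0.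
rewrite andbT mulr1n; case: (odd i); case: (odd i') => /=;
  rewrite ?expr0 ?expr1 ?subrr ?mul0r ?mulr0n// mulr1n -addnn natrD; ring.
Qed.

End hadamard.

(** * Norm and range of the Hadamard coordinates *)

Section hadamard_coordinates.
Variables (R : realType) (n k : nat) (p : R).
Hypothesis p_ge1 : 1 <= p.
Local Notation m := (2 ^ k)%N.
Implicit Types x y : 'rV[R]_n.

Let p_gt0 : 0 < p. Proof. exact: lt_le_trans p_ge1. Qed.
Let p_neq0 : p != 0. Proof. by rewrite gt_eqF. Qed.
Let m_gt0 : 0 < (m%:R : R). Proof. by rewrite ltr0n expn_gt0. Qed.

(** A row of [m] signs has dual norm m^(1 - 1/p), which the factor in front normalizes to 1. *)
Definition hadamard_coord (i : nat) x : R :=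
  m%:R `^ (p^-1 - 1) * \sum_(j < n | (j < m)%N) hadamard R k i j * x ord0 j.

Lemma hadamard_coord_linear i (a b : R) x y :
  hadamard_coord i (a *: x + b *: y) = a * hadamard_coord i x + b * hadamard_coord i y.
Proof.
rewrite /hadamard_coord !(mulrCA _ (_ `^ _)) -mulrDr; congr (_ * _).
rewrite !mulr_sumr -big_split/=; apply: eq_bigr => j _.
by rewrite !mxE; ring.
Qed.

Lemma hadamard_coordB i x y :
  hadamard_coord i (x - y) = hadamard_coord i x - hadamard_coord i y.
Proof.
have := hadamard_coord_linear i 1 (-1) x y.
by rewrite scale1r scaleN1r mul1r mulN1r.
Qed.

Lemma norm_hadamard i j : `|hadamard R k i j| = 1.
Proof.
apply/eqP; rewrite -(@eqrXn2 _ 2)// expr1n -normrX expr2 hadamard_sqr.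
by rewrite normr1.
Qed.

(** Young's inequality for the product of [u] and 1. At [s = 1] the conjugate exponent would be
    infinite, hence the separate case. *)
Lemma young_powR (s u : R) : 1 <= s -> 0 <= u -> u <= u `^ s / s + (1 - s^-1).
Proof.
move=> s1 u0; have [->|s_neq1] := eqVneq s 1.
  by rewrite powRr1// invr1 mulr1 subrr addr0.
have s_gt1 : 1 < s by rewrite lt_neqAle eq_sym s_neq1.
have s_gt0 : 0 < s by exact: lt_trans s_gt1.
have q_gt0 : 0 < (1 - s^-1)^-1 by rewrite invr_gt0 subr_gt0 invf_lt1.
have := @conjugate_powR R u 1 s (1 - s^-1)^-1 u0 ler01 s_gt0 q_gt0.
by rewrite invrK subrKC powR1 mulr1 mul1r; apply.
Qed.

Lemma card_lt_m : (#|[pred j : 'I_n | (j < m)%N]| <= m)%N.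
Proof.
have [nm|mn] := leqP n m.
  by apply: leq_trans nm; rewrite -[leqRHS]card_ord max_card.
rewrite -sum1_card -(big_ord_widen n (fun=> 1%N) (ltnW mn)).
by rewrite sum1_card card_ord.
Qed.

(* Hoelder's inequality, the row having entries of absolute value m^(1/p - 1). *)
Lemma hadamard_coord_le i x : `|hadamard_coord i x| <= lp_norm p x.
Proof.
set N := lp_norm p x; have N0 : 0 <= N by exact: powR_ge0.
pose S := \sum_(j < n) `|x ord0 j| `^ p.
have S0 : 0 <= S by apply: sumr_ge0 => j _; exact: powR_ge0.
have NS : N `^ p = S by rewrite /N /lp_norm -powRrM mulVf// powRr1.
rewrite normrM ger0_norm ?powR_ge0//.
have tri : `|\sum_(j < n | (j < m)%N) hadamard R k i j * x ord0 j|
    <= \sum_(j < n | (j < m)%N) `|x ord0 j|.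
  apply: le_trans (ler_norm_sum _ _ _) _; apply: ler_sum => j _.
  by rewrite normrM norm_hadamard mul1r.
apply: le_trans (ler_wpM2l (powR_ge0 _ _) tri) _.
have [N_eq0|N_neq0] := eqVneq N 0.
  rewrite big1 ?mulr0// => j _.
  have Seq0 : S = 0 by rewrite -NS N_eq0 powR0.
  have : `|x ord0 j| `^ p == 0.
    rewrite eq_le powR_ge0 andbT -Seq0 /S (bigD1 j)//= lerDl.
    by apply: sumr_ge0 => ? _; exact: powR_ge0.
  by rewrite powR_eq0 => /andP[/eqP].
have N_gt0 : 0 < N by rewrite lt_neqAle eq_sym N_neq0.
pose M : R := m%:R `^ p^-1.
have M_gt0 : 0 < M by exact: powR_gt0.
have Mp : M `^ p = m%:R by rewrite /M -powRrM mulVf// powRr1 ?ltW.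
(* Young's inequality is applied to each term; the [p]-th powers of the terms add up to at most
   [m]. *)
have bound : \sum_(j < n | (j < m)%N) (M * `|x ord0 j| / N) <= m%:R.
  apply: (@le_trans _ _ (\sum_(j < n | (j < m)%N)
      (m%:R / S / p * `|x ord0 j| `^ p + (1 - p^-1)))).
    apply: ler_sum => j _; apply: le_trans (@young_powR p _ p_ge1 _) _.
      by rewrite divr_ge0 ?mulr_ge0// ltW.
    rewrite lerD2r powRM ?mulr_ge0 ?invr_ge0// ?(ltW M_gt0)// powRM ?(ltW M_gt0)//.
    rewrite Mp -powR_inv1// -powRrM mulN1r powRN NS.
    by rewrite le_eqVlt; apply/orP; left; apply/eqP; ring.
  rewrite big_split/= -mulr_sumr sumr_const.
  have Sle : \sum_(j < n | (j < m)%N) `|x ord0 j| `^ p <= S.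
    rewrite /S [leRHS](bigID (fun j : 'I_n => (j < m)%N))/= lerDl.
    by apply: sumr_ge0 => j _; exact: powR_ge0.
  have S_gt0 : 0 < S by rewrite -NS powR_gt0.
  apply: (@le_trans _ _ (m%:R / S / p * S + m%:R * (1 - p^-1))).
    apply: lerD; first by rewrite ler_wpM2l// !divr_ge0// ltW.
    rewrite -[leLHS]mulr_natl ler_wpM2r ?ler_nat ?card_lt_m//.
    by rewrite subr_ge0 invf_le1.
  rewrite le_eqVlt; apply/orP; left; apply/eqP.
  by field; rewrite p_neq0 gt_eqF.
rewrite powRB; last by rewrite (gt_eqF m_gt0) implybT.
rewrite powRr1 ?(ltW m_gt0)// -/M.
move: bound; rewrite -mulr_suml -mulr_sumr ler_pdivrMr// => bound.
by rewrite mulrAC ler_pdivrMr// [leRHS]mulrC.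
Qed.

(** The preimage is m^(-1/p) H c, padded with zeros, where H is symmetric with H H = m I. The
    squares of the entries of H c add up to m times those of c, hence to at most [m], and [p < 2]
    turns this into a bound on the [p]-th powers. *)
Lemma hadamard_coord_onto (c : 'I_m -> R) : p < 2 -> (m <= n)%N ->
  (forall i, m%:R * c i ^+ 2 <= 1) ->
  exists2 x, lp_norm p x <= 1 & forall i : 'I_m, hadamard_coord i x = c i.
Proof.
move=> p_lt2 mn c_le.
pose g (j : nat) := \sum_(i < m) hadamard R k i j * c i.
pose M : R := m%:R `^ p^-1.
have M_gt0 : 0 < M by exact: powR_gt0.
have Mp : M `^ p = m%:R by rewrite /M -powRrM mulVf// powRr1 ?ltW.
pose x : 'rV[R]_n := \row_j if (j < m)%N then M^-1 * g j else 0.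
have hadS i j : hadamard R k i j = hadamard R k j i.
  by elim: k i j => //= k' IH i j; rewrite andbC IH.
exists x => [|i]; last first.
  rewrite /hadamard_coord powRB; last by rewrite (gt_eqF m_gt0) implybT.
  rewrite powRr1 ?(ltW m_gt0)// -/M.
  under eq_bigr => j jm do rewrite mxE jm.
  rewrite -(big_ord_widen n (fun j => hadamard R k i j * (M^-1 * g j)) mn).
  under eq_bigr => j _ do rewrite mulrCA mulr_sumr.
  rewrite -mulr_sumr exchange_big/=.
  under eq_bigr => i' _.
    under eq_bigr => j _ do rewrite mulrA.
    rewrite -mulr_suml hadamard_orthogonal//.
    over.
  rewrite (bigD1 i)//= eqxx mulr1n big1 ?addr0; last first.
    by move=> i' /negPf; rewrite eq_sym => ne; rewrite [_ == _ :> nat]ne mulr0n mul0r.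
  by field; rewrite !gt_eqF.
have g2 : \sum_(j < m) g j ^+ 2 <= m%:R.
  have -> : \sum_(j < m) g j ^+ 2 = \sum_(i < m) m%:R * c i ^+ 2.
    under eq_bigr => j _.
      rewrite expr2 {1}/g mulr_suml.
      under eq_bigr => i _ do rewrite /g mulr_sumr.
      over.
    rewrite exchange_big/=; apply: eq_bigr => i _.
    rewrite exchange_big/= (bigD1 i)//= [X in _ + X]big1 ?addr0 => [|i' ne].
      under eq_bigr => j _ do rewrite mulrACA hadamard_sqr mul1r.
      by rewrite sumr_const card_ord -[LHS]mulr_natl expr2.
    under eq_bigr => j _ do rewrite mulrACA.
    rewrite -mulr_suml hadamard_orthogonal// eq_sym.
    by rewrite [_ == _ :> nat](negPf ne) mulr0n mul0r.
  apply: le_trans (ler_sum _ (fun i _ => c_le i)) _.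
  by rewrite sumr_const card_ord.
have pow1 : (1 : R) `^ p^-1 = 1 by rewrite powR1.
rewrite /lp_norm -[leRHS]pow1; apply: ge0_ler_powR;
  rewrite ?nnegrE ?invr_ge0 ?(ltW p_gt0)//.
  by apply: sumr_ge0 => j _; exact: powR_ge0.
have -> : \sum_(j < n) `|x ord0 j| `^ p = \sum_(j < m) m%:R^-1 * `|g j| `^ p.
  rewrite (big_ord_widen n (fun j => m%:R^-1 * `|g j| `^ p) mn).
  rewrite [RHS]big_mkcond; apply: eq_bigr => j _; rewrite mxE.
  case: ifP => jm; last by rewrite normr0 powR0.
  rewrite normrM powRM// ger0_norm ?invr_ge0 ?(ltW M_gt0)//; congr (_ * _).
  by rewrite -powR_inv1 ?ltW// -powRrM mulN1r powRN Mp.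
rewrite -mulr_sumr ler_pdivrMl// mulr1.
(* Young's inequality with exponent [2 / p] compares the [p]-th power of [g j] with its square. *)
have s1 : 1 <= 2 / p by rewrite ler_pdivlMr// mul1r ltW.
apply: (@le_trans _ _ (\sum_(j < m) (g j ^+ 2 * (p / 2) + (1 - p / 2)))).
  apply: ler_sum => j _; apply: le_trans (young_powR s1 (powR_ge0 _ _)) _.
  rewrite -powRrM mulrCA divff// mulr1 invf_div powR_mulrn// real_normK//.
  exact: num_real.
rewrite big_split/= -mulr_suml sumr_const card_ord -[_ *+ m]mulr_natl.
have : (\sum_(j < m) g j ^+ 2) * (p / 2) <= m%:R * (p / 2).
  by rewrite ler_wpM2r// divr_ge0 ?ltW.
rewrite mulrBr mulr1; lra.
Qed.

End hadamard_coordinates.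

(** * The hard family *)

(** All elements lie in the interval of length [d] that starts at the least one. *)
Lemma card_window (q d : nat) (S : {set 'I_q}) :
  (forall a a', a \in S -> a' \in S -> (a < a' + d)%N) -> (#|S| <= d)%N.
Proof.
move=> Sd; have [->|[a0 a0S]] := set_0Vmem S; first by rewrite cards0.
have [b bS bmin] := arg_minnP (fun a : 'I_q => nat_of_ord a) a0S.
rewrite cardE -(size_map val) -[d](size_iota b); apply: uniq_leq_size.
  by rewrite map_inj_uniq ?enum_uniq//; exact: val_inj.
move=> _ /mapP[a + ->]; rewrite mem_enum mem_iota => aS.
by rewrite bmin//= Sd.
Qed.

Section hard_family.
Variables (R : realType) (n k L : nat) (p : R).
Hypothesis p_ge1 : 1 <= p.
Local Notation m := (2 ^ k)%N.
Local Notation q := (16 * 2 ^ k)%N.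
Local Notation cell := ('I_L * 'I_m)%type.
Local Notation inst := {ffun cell -> 'I_q}.
Implicit Types (x y : 'rV[R]_n) (e : cell) (s : inst).

Definition level e : nat := e.1.

(* With ratio 64 all the centres beyond level r stay within [tolerance r] / 2
   of the centre at level r; the slope ratio 4 then hides the levels beyond r
   wherever the latter is off by at least [tolerance r]. *)
Definition step (r : nat) : R := (2 * Num.sqrt m%:R)^-1 / 64 ^+ r.
Definition tolerance r : R := step r / 16.
Definition slope (r : nat) : R := (4 ^+ r)^-1.

Definition center e s : R :=
  \sum_(r < L | (r <= e.1)%N) step r * ((s (r, e.2))%:R / q%:R).

Definition dist x e s : R := `|hadamard_coord k p e.2 x - center e s|.

Definition piece e s x : R := slope e.1 * (dist x e s - tolerance e.1 / 2).

Definition hard_fun s x : R := \big[Num.max/0]_e piece e s x.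

Let m_gt0 : 0 < (m%:R : R). Proof. by rewrite ltr0n expn_gt0. Qed.
Let q_gt0 : 0 < (q%:R : R). Proof. by rewrite natrM mulr_gt0. Qed.

Lemma step_gt0 r : 0 < step r.
Proof. by rewrite divr_gt0 ?exprn_gt0// invr_gt0 mulr_gt0// sqrtr_gt0. Qed.

Lemma stepS r : step r.+1 = step r / 64.
Proof. by rewrite /step exprSr (invfM (64 ^+ r)) mulrA. Qed.

Lemma tolerance_gt0 r : 0 < tolerance r.
Proof. by rewrite divr_gt0// step_gt0. Qed.

Lemma slope_gt0 r : 0 < slope r.
Proof. by rewrite invr_gt0 exprn_gt0. Qed.

Lemma slope_decr r r' : (r < r')%N -> slope r' <= slope r / 4.
Proof.
move=> rr'; rewrite /slope -invfM -exprSr lef_pV2 ?posrE ?exprn_gt0//.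
by rewrite ler_weXn2l// ler1n.
Qed.

Lemma slope_le1 r : slope r <= 1.
Proof. by rewrite invf_le1 ?exprn_gt0// exprn_ege1// ler1n. Qed.

Lemma letter_ge0 (a : 'I_q) : 0 <= a%:R / q%:R :> R.
Proof. by rewrite divr_ge0// ltW. Qed.

Lemma letter_le1 (a : 'I_q) : a%:R / q%:R <= 1 :> R.
Proof. by rewrite ler_pdivrMr// mul1r ler_nat ltnW. Qed.

Lemma sum_step_tail r M : \sum_(j < M | (r < j)%N) step j <= step r / 63.
Proof.
(* The claim is strengthened by the rest of the geometric series of ratio 1/64, which is 1/63 of the
   last term; [maxn] covers the [M] for which the sum is still empty. *)
suff: \sum_(j < M | (r < j)%N) step j + step (maxn r M.-1) / 63 <= step r / 63.
  by apply: le_trans; rewrite lerDl divr_ge0// ltW// step_gt0.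
elim: M => [|M IHM]; first by rewrite big_ord0 add0r maxn0.
rewrite big_mkcond big_ord_recr/= -big_mkcond/=.
have [rM|Mr] := ltnP r M; last first.
  by rewrite addr0; move: IHM; rewrite (maxn_idPl _)// (leq_trans (leq_pred _)).
case: M => // M in IHM rM *.
by move: IHM; rewrite (maxn_idPr _)//= stepS; lra.
Qed.

Lemma center_ge0 e s : 0 <= center e s.
Proof.
by apply: sumr_ge0 => r _; rewrite mulr_ge0 ?letter_ge0// ltW// step_gt0.
Qed.

(** The steps add up to at most 64/63 of [step 0], and [2 * step 0] is the side of the cube of
    attained coordinates. *)
Lemma center_le e s : center e s <= (Num.sqrt m%:R)^-1.
Proof.
apply: (@le_trans _ _ (\sum_(r < L) step r)).
  rewrite /center big_mkcond/=; apply: ler_sum => r _; case: ifP => _; last first.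
    by rewrite ltW// step_gt0.
  by rewrite ler_piMr ?letter_le1// ltW// step_gt0.
apply: (@le_trans _ _ (step 0 + step 0 / 63)); last first.
  have : 2 * step 0 = (Num.sqrt m%:R)^-1.
    by rewrite /step expr0 divr1 invfM mulrA divff ?mul1r.
  have := step_gt0 0; lra.
have := @sum_step_tail 0 L; rewrite big_mkcond/=.
case: L => [|L']; first by rewrite !big_ord0 => _; have := step_gt0 0; lra.
by rewrite !big_ord_recl/= add0r => ?; rewrite lerD2l.
Qed.

(** The centres share the letters up to level [e.1], and the steps beyond it add up to at most 1/63
    of [step e.1], whereas half the tolerance is 1/32 of it. *)
Lemma center_diff e e' s : (e.1 <= e'.1)%N -> e.2 = e'.2 ->
  `|center e' s - center e s| <= tolerance e.1 / 2.
Proof.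
move=> le12 ee; rewrite /center (bigID (fun r : 'I_L => (r <= e.1)%N))/=.
rewrite (eq_bigl (fun r : 'I_L => (r <= e.1)%N)); last first.
  by move=> r /=; apply/andP/idP => [[]//|re]; split=> //; exact: leq_trans le12.
rewrite ee addrAC subrr add0r ger0_norm; last first.
  by apply: sumr_ge0 => r _; rewrite mulr_ge0 ?letter_ge0// ltW// step_gt0.
apply: (@le_trans _ _ (\sum_(j < L | (e.1 < j)%N) step j)).
  rewrite [leRHS]big_mkcond [leLHS]big_mkcond; apply: ler_sum => r _.
  rewrite -ltnNge; case: ifP => [/andP[_ ->]|_].
    by rewrite ler_piMr ?letter_le1// ltW// step_gt0.
  by case: ifP => // _; rewrite ltW// step_gt0.
apply: le_trans (sum_step_tail _ _) _; rewrite /tolerance.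
have := step_gt0 e.1; lra.
Qed.

Lemma dist_diff e e' s x : (e.1 <= e'.1)%N -> e.2 = e'.2 ->
  dist x e' s <= dist x e s + tolerance e.1 / 2.
Proof.
move=> le12 ee; have cd := center_diff s le12 ee.
apply: (@le_trans _ _ (dist x e s + `|center e' s - center e s|)); last first.
  by rewrite lerD2l.
rewrite /dist ee [`|center _ _ - _|]distrC.
by apply: le_trans (ler_normD _ _); rewrite addrA subrK.
Qed.

Lemma center_dep e s s' : (forall e', (level e' < level e)%N -> s e' = s' e') ->
  s e = s' e -> center e s = center e s'.
Proof.
move=> ss' se; apply: eq_bigr => r; rewrite leq_eqVlt => /orP[/eqP re|re].
  have -> : (r, e.2) = e by rewrite (val_inj re : r = e.1) -surjective_pairing.
  by rewrite se.
by rewrite (ss' (r, e.2)).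
Qed.

Lemma dist_dep x e s s' : (forall e', (level e' < level e)%N -> s e' = s' e') ->
  s e = s' e -> dist x e s = dist x e s'.
Proof. by move=> H1 H2; rewrite /dist (center_dep H1 H2). Qed.

Lemma piece_dep e s s' : (forall e', (level e' < level e)%N -> s e' = s' e') ->
  s e = s' e -> piece e s = piece e s'.
Proof. by move=> H1 H2; apply/funext => x; rewrite /piece (dist_dep x H1 H2). Qed.

Lemma dist_update x e s : exists z : R, forall a,
  dist x e (update s e a) = `|z - step e.1 / q%:R * a%:R|.
Proof.
exists (hadamard_coord k p e.2 x
        - \sum_(r < L | (r < e.1)%N) step r * ((s (r, e.2))%:R / q%:R)) => a.
rewrite /dist /center (bigD1 e.1)//= -surjective_pairing ffunE eqxx.
rewrite opprD addrCA addrC; congr `| _ - _ + _|; last by ring.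
apply: eq_big => [r|r /andP[_ re]].
  by rewrite [RHS]ltn_neqAle andbC.
rewrite ffunE ifF//; apply: contraNF re => /eqP/(congr1 fst)/= ->; exact: eqxx.
Qed.

Lemma dist_ties x e s v :
  (#|[set a | dist x e (update s e a) == v]| <= 2)%N.
Proof.
have [z zE] := dist_update x e s; set w := step e.1 / q%:R in zE.
have w0 : w != 0 by rewrite gt_eqF// divr_gt0 ?step_gt0.
have one (u : R) : (#|[set a : 'I_q | (w * a%:R == u)%R]| <= 1)%N.
  apply/card_le1_eqP => a b; rewrite !inE => /eqP <- /eqP /(mulfI w0) /eqP.
  by rewrite eqr_nat => /eqP /val_inj.
apply: (@leq_trans #|[set a : 'I_q | (w * a%:R == z - v)%R]
                     :|: [set a : 'I_q | (w * a%:R == z + v)%R]|).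
  apply: subset_leq_card; apply/fintype.subsetP => a; rewrite !inE zE => /eqP av.
  have [z0|z0] := leP 0 (z - w * a%:R).
    by apply/orP; left; rewrite -av ger0_norm// opprB [z + _]addrC subrK.
  by apply/orP; right; rewrite -av ltr0_norm// opprB [z + _]addrC subrK.
by apply: leq_trans (leq_card_setU _ _) _; apply: (@leq_add _ _ 1 1).
Qed.

Lemma dist_small x e s :
  #|[set a | dist x e (update s e a) < tolerance (level e)]|%:R <= (4 * m)%:R :> R.
Proof.
have [z zE] := dist_update x e s; set w := step e.1 / q%:R in zE.
have w0 : 0 < w by rewrite divr_gt0 ?step_gt0.
(* The tolerance spans [m] letters on either side, so [2 * m] in all. The doubled bound [4 * m]
   serves [tie_factor]: (1 + 1 / m)^m would exceed 2 for m > 1. *)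
rewrite ler_nat; apply: (@leq_trans (2 * m)%N); last by rewrite leq_mul2r orbT.
apply: card_window => a b; rewrite !inE !zE /level.
have -> : tolerance e.1 = w * m%:R.
  by rewrite /tolerance /w natrM; field; rewrite gt_eqF.
rewrite !ltr_norml => /andP[a1 a2] /andP[b1 b2].
rewrite -(ltr_nat R) natrD natrM -(ltr_pM2l w0); lra.
Qed.

Lemma hard_fun_ge0 s x : 0 <= hard_fun s x.
Proof. exact: bigmax_ge_id. Qed.

Lemma piece_le s x e : piece e s x <= hard_fun s x.
Proof. exact: (le_bigmax _ (fun e => piece e s x)). Qed.

Lemma dist_conv e s x y (t : R) : 0 <= t <= 1 ->
  dist (t *: x + (1 - t) *: y) e s <= t * dist x e s + (1 - t) * dist y e s.
Proof.
move=> /andP[t0 t1]; rewrite /dist hadamard_coord_linear.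
have abs (u v : R) : 0 <= u -> u * `|v| = `|u * v|.
  by move=> u0; rewrite normrM (ger0_norm u0).
rewrite !abs ?subr_ge0//; apply: le_trans (ler_normD _ _).
by rewrite le_eqVlt; apply/orP; left; apply/eqP; congr `| _ |; ring.
Qed.

Lemma hard_fun_conv s x y (t : R) : 0 <= t <= 1 ->
  hard_fun s (t *: x + (1 - t) *: y) <= t * hard_fun s x + (1 - t) * hard_fun s y.
Proof.
move=> t01; have /andP[t0 t1] := t01; have t1' : 0 <= 1 - t by rewrite subr_ge0.
apply/bigmax_leP; split=> [|e _].
  by rewrite addr_ge0// mulr_ge0// hard_fun_ge0.
apply: (@le_trans _ _ (t * piece e s x + (1 - t) * piece e s y)); last first.
  by rewrite lerD// ler_wpM2l// piece_le.
apply: (@le_trans _ _ (slope e.1 *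
    (t * dist x e s + (1 - t) * dist y e s - tolerance e.1 / 2))).
  by rewrite ler_wpM2l ?lerD2r ?dist_conv// ltW// slope_gt0.
by rewrite le_eqVlt; apply/orP; left; apply/eqP; rewrite /piece; ring.
Qed.

Lemma piece_lip e s x y : piece e s x <= piece e s y + lp_norm p (x - y).
Proof.
have N0 : 0 <= lp_norm p (x - y) by exact: powR_ge0.
have H : dist x e s <= dist y e s + lp_norm p (x - y).
  rewrite /dist; apply: (@le_trans _ _ (`|hadamard_coord k p e.2 y - center e s|
      + `|hadamard_coord k p e.2 (x - y)|)).
    rewrite hadamard_coordB; apply: le_trans (ler_normD _ _).
    by rewrite le_eqVlt; apply/orP; left; apply/eqP; congr `| _ |; ring.
  by rewrite lerD2l hadamard_coord_le.
apply: (@le_trans _ _ (slope e.1 * (dist y e s + lp_norm p (x - y) - tolerance e.1 / 2))).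
  by rewrite ler_wpM2l ?lerD2r// ltW// slope_gt0.
by rewrite /piece addrAC mulrDr lerD2l ler_piMl// slope_le1.
Qed.

Lemma hard_fun_lip s x y : `|hard_fun s x - hard_fun s y| <= lp_norm p (x - y).
Proof.
have N0 u : 0 <= lp_norm p (u : 'rV[R]_n) by exact: powR_ge0.
have half u v : hard_fun s u - hard_fun s v <= lp_norm p (u - v).
  rewrite lerBlDl; apply/bigmax_leP; split=> [|e _].
    by rewrite addr_ge0// hard_fun_ge0.
  by apply: le_trans (piece_lip _ _ _ v) _; rewrite lerD2r piece_le.
have NC : lp_norm p (x - y) = lp_norm p (y - x).
  rewrite /lp_norm (eq_bigr (fun i => `|(y - x) ord0 i| `^ p))// => i _.
  by rewrite !mxE distrC.
by rewrite ler_norml half andbT NC lerNl opprB half.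
Qed.

(** The minimizer has the centres of the last level as coordinates: each centre is within half its
    tolerance of them, so no piece is positive. *)
Lemma hard_fun_min s : p < 2 -> (m <= n)%N ->
  exists2 x, lp_norm p x <= 1 & hard_fun s x = 0.
Proof.
move=> p_lt2 mn.
have onto (c : 'I_m -> R) : (forall i, 0 <= c i <= (Num.sqrt m%:R)^-1) ->
    exists2 x : 'rV[R]_n, lp_norm p x <= 1 &
      forall i : 'I_m, hadamard_coord k p i x = c i.
  move=> c01; apply: (@hadamard_coord_onto R n k p p_ge1 c p_lt2 mn) => i.
  have /andP[c0 c1] := c01 i.
  rewrite -ler_pdivlMl// mulr1 -[m%:R in leRHS]sqr_sqrtr ?(ltW m_gt0)// -exprVn.
  by rewrite ler_sqr ?nnegrE// invr_ge0 sqrtr_ge0.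
have le0 x : (forall e, piece e s x <= 0) -> hard_fun s x = 0.
  move=> px; apply/eqP; rewrite eq_le hard_fun_ge0 andbT.
  by apply/bigmax_leP; split.
have [L0|L_gt0] := posnP L.
  have [|x x1 _] := onto (fun=> 0).
    by move=> i; rewrite lexx invr_ge0 sqrtr_ge0.
  by exists x => //; apply: le0 => -[r i]; move: (ltn_ord r); rewrite {2}L0.
have lastL : (L.-1 < L)%N by rewrite prednK.
pose rl := Ordinal lastL.
have [i|x x1 xc] := onto (fun i => center (rl, i) s).
  by rewrite center_ge0 center_le.
exists x => //; apply: le0 => e; rewrite /piece pmulr_rle0 ?slope_gt0//.
rewrite subr_le0 /dist xc; apply: (@center_diff e (rl, e.2)) => //=.
by rewrite -ltnS prednK.
Qed.

Lemma dist_lt_tolerance s x e eps : hard_fun s x < eps ->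
  eps <= slope e.1 * (tolerance e.1 / 2) -> dist x e s < tolerance (level e).
Proof.
move=> fx /(lt_le_trans (le_lt_trans (piece_le s x e) fx)).
by rewrite /piece ltr_pM2l ?slope_gt0// ltrBlDr -splitr.
Qed.

(** A deeper level adds at most D / 2 to the distance but divides the slope by at least 4, and 3/8 D
    is less than D / 2, which is at most [D - tolerance e.1 / 2]. *)
Lemma piece_deeper s x e e' (D : R) : (e.1 < e'.1)%N -> tolerance e.1 <= D ->
  dist x (e.1, e'.2) s <= D -> piece e' s x < slope e.1 * (D - tolerance e.1 / 2).
Proof.
move=> ee' rD dD; have r0 := tolerance_gt0 e.1; have r0' := tolerance_gt0 e'.1.
have d' := @dist_diff (e.1, e'.2) e' s x (ltnW ee') erefl.
have sl := slope_decr ee'; have sl0 := slope_gt0 e.1.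
apply: (@le_lt_trans _ _ (slope e'.1 * (3 / 2 * D))).
  rewrite /piece ler_pM2l ?slope_gt0//; move: d' => /=; lra.
apply: (@le_lt_trans _ _ (slope e.1 / 4 * (3 / 2 * D))).
  by rewrite ler_wpM2r//; lra.
by rewrite -mulrA ltr_pM2l//; lra.
Qed.

Lemma hadamard_coord_continuous i :
  continuous (hadamard_coord k p i : 'rV[R]_n -> R).
Proof.
have cts : continuous (fun x : 'rV[R]_n =>
    \sum_(j < n | (j < m)%N) hadamard R k i j * x ord0 j).
  apply: continuous_big; first exact: add_continuous.
  move=> j _ x; have := @coord_continuous R 1 n ord0 j x.
  by move/(cvgM (cvg_cst (hadamard R k i j))); exact.
by move=> x; have /(cvgM (cvg_cst (m%:R `^ (p^-1 - 1)))) := cts x; exact.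
Qed.

Lemma piece_continuous e s : continuous (piece e s).
Proof.
move=> x; have coord_cts := @hadamard_coord_continuous e.2 x.
have c1 : (dist y e s @[y --> x] --> dist x e s)%classic.
  exact: (cvg_norm (cvgB coord_cts (cvg_cst (center e s)))).
have c2 : (dist y e s - tolerance e.1 / 2 @[y --> x]
    --> dist x e s - tolerance e.1 / 2)%classic.
  exact: (cvgB c1 (cvg_cst (tolerance e.1 / 2))).
exact: (cvgM (cvg_cst (slope e.1)) c2).
Qed.

(** Each piece either is the same function for both instances or lies strictly below the common
    piece of [e0] at [x], for both. By continuity and finiteness the latter pieces stay below near
    [x] and do not affect the maxima. *)
Lemma hard_fun_near s s' x e0 :
  (forall e, (level e < level e0)%N -> s e = s' e) -> s e0 = s' e0 ->
  tolerance (level e0) <= dist x e0 s ->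
  (forall e, level e = level e0 ->
     [/\ dist x e s <= dist x e0 s, dist x e s' <= dist x e0 s' &
      s e = s' e \/
      (dist x e s < dist x e0 s /\ dist x e s' < dist x e0 s')]) ->
  \forall y \near nbhs x, hard_fun s y = hard_fun s' y.
Proof.
move=> low s0 rD same.
have D0 : dist x e0 s = dist x e0 s' by exact: dist_dep.
have P0 : piece e0 s = piece e0 s' by exact: piece_dep.
have agree e : piece e s = piece e s' \/
    (piece e s x < piece e0 s x /\ piece e s' x < piece e0 s x).
  have deep (s2 : inst) : (forall e, level e = level e0 ->
        dist x e s2 <= dist x e0 s2) -> dist x e0 s2 = dist x e0 s ->
      (level e0 < level e)%N -> piece e s2 x < piece e0 s x.
    move=> le2 eq2 lev; apply: piece_deeper => //.
    by rewrite -eq2 le2.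
  have [lev|lev|lev] := ltngtP (level e) (level e0).
  - left; apply: piece_dep => [e' e'e|]; last exact: low.
    by apply: low; exact: ltn_trans lev.
  - right; split; first by apply: deep => // e' /same[].
    by apply: deep => // e' /same[].
  - have [_ _ [se|[lt1 lt2]]] := same e lev.
      by left; apply: piece_dep => // e' e'e; apply: low; rewrite -lev.
    right; rewrite {2}P0 /piece.
    have -> : e.1 = e0.1 by exact: val_inj.
    by rewrite !ltr_pM2l ?slope_gt0// !ltrD2r.
have lt_near s2 e : piece e s2 x < piece e0 s x ->
    \forall y \near nbhs x, piece e s2 y < piece e0 s y.
  move=> lt2; have cts : (piece e0 s y - piece e s2 y @[y --> x] -->
      piece e0 s x - piece e s2 x)%classic.
    exact: (cvgB (@piece_continuous e0 s x) (@piece_continuous e s2 x)).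
  have gt0 : 0 < piece e0 s x - piece e s2 x by rewrite subr_gt0.
  by apply: filterS (cvgr_gt _ cts _ gt0) => y; rewrite subr_gt0.
have agree_near : \forall y \near nbhs x, forall e, piece e s = piece e s' \/
    (piece e s y < piece e0 s y /\ piece e s' y < piece e0 s y).
  apply: filter_forall => e.
  have [E|[/lt_near lt1 /lt_near lt2]] := agree e.
    by apply: nearW => y; left.
  by apply: filterS2 lt1 lt2 => y ? ?; right.
apply: filterS agree_near => y ag; apply/eqP; rewrite eq_le.
apply/andP; split; apply/bigmax_leP; split=> [|e _]; rewrite ?hard_fun_ge0//.
  have [->|[/ltW le1 _]] := ag e; first exact: piece_le.
  by apply: le_trans le1 _; rewrite P0 piece_le.
have [<-|[_ /ltW le2]] := ag e; first exact: piece_le.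
by apply: le_trans le2 _; exact: piece_le.
Qed.

End hard_family.

(** * The hard functions as a family, and its solved instances *)

Section hard_instances.
Variables (R : realType) (n k L : nat) (p : R).
Hypotheses (p_ge1 : 1 <= p) (p_lt2 : p < 2) (mn : (2 ^ k <= n)%N).
Local Notation m := (2 ^ k)%N.
Local Notation q := (16 * 2 ^ k)%N.
Local Notation cell := ('I_L * 'I_m)%type.
Local Notation inst := {ffun cell -> 'I_q}.

Lemma card_inst : #|{: inst}| = ((16 * m) ^ (L * m))%N.
Proof. by rewrite card_ffun card_prod !card_ord. Qed.

Lemma card_inst_gt0 : (0 < #|{: inst}|)%N.
Proof. by rewrite card_inst expn_gt0 muln_gt0 expn_gt0. Qed.

Definition instance (i : 'I_#|{: inst}|.-1.+1) : inst :=
  enum_val (cast_ord (prednK card_inst_gt0) i).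

Lemma instance_inj : injective instance.
Proof. by move=> i j /enum_val_inj /cast_ord_inj. Qed.

Lemma hard_fun_convex_function (i : 'I_#|{: inst}|.-1.+1) :
  convex_function (lp_ball n p) (hard_fun p (instance i) : 'rV[R]_n -> R).
Proof.
move=> t x y _ _; apply: hard_fun_conv => //.
by rewrite ge0 le1.
Qed.

(* Ties being counted for, no continuous perturbation is needed: the box is R^0. *)
Definition hard_family : convex_family n p :=
  @ConvexFamily R n p #|{: inst}|.-1 [::] (fun i _ => hard_fun p (instance i))
    (fun i _ _ => @hard_fun_convex_function i)
    (fun i _ _ x y _ _ => hard_fun_lip p_ge1 (instance i) x y)
    (fun i x _ => measurable_cst (hard_fun p (instance i) x)).

Variable eps : R.
Hypothesis eps_small : forall r, (r < L)%N -> eps <= slope R r * (tolerance R k r / 2).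

Lemma inf_hard_fun (s : inst) : inf (hard_fun p s @` lp_ball n p)%classic <= 0.
Proof.
have [x x1 fx] := hard_fun_min p_ge1 s p_lt2 mn.
rewrite -fx; apply: ge_inf; last by exists x.
by exists 0 => _ [y _ <-]; exact: hard_fun_ge0.
Qed.

Lemma eps_minimum_dist (s : inst) (x : lp_ball n p) (e : cell) :
  eps_minimum eps (hard_fun p s) x ->
  dist p (val x) e s < tolerance R k (level e).
Proof.
move=> /lt_le_trans xmin; apply: (@dist_lt_tolerance _ _ _ _ _ _ _ _ eps).
  by apply: xmin; rewrite gerDr inf_hard_fun.
exact: eps_small.
Qed.

(** From 1 + x <= exp x the power is at most exp(1/2), and the same inequality gives exp(-1/2) >=
    1/2. *)
Lemma tie_factor : (1 + 2 / (4 * m)%:R) ^+ m <= 2 :> R.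
Proof.
have m0 : 0 < (m%:R : R) by rewrite ltr0n expn_gt0.
have -> : 2 / (4 * m)%:R = (2 * m%:R)^-1 :> R.
  by rewrite natrM; field; rewrite gt_eqF.
apply: (@le_trans _ _ (expR (2 * m%:R)^-1 ^+ m)).
  have x0 : 0 <= (2 * m%:R)^-1 :> R by rewrite invr_ge0 mulr_ge0// ltW.
  by rewrite lerXn2r ?nnegrE ?expR_ge0 ?addr_ge0// expR_ge1Dx.
rewrite -expRM_natr.
have -> : (2 * m%:R)^-1 * m%:R = 2^-1 :> R by field; rewrite gt_eqF.
have := expR_ge1Dx (- 2^-1 : R); rewrite expRN => H.
have : 2^-1 <= (expR 2^-1)^-1 :> R by apply: le_trans H; lra.
by rewrite lef_pV2 ?posrE ?expR_gt0.
Qed.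

Variables (A : Type) (O : oracle n p A).
Hypothesis O_local : local_oracle hard_family O.
Variable next : seq A -> action (lp_ball n p).

(** As runs are frozen at their output, these are the instances solved with at most [t] queries. *)
Definition solved_by (t : nat) : {set 'I_#|{: inst}|.-1.+1} :=
  [set i | `[< exists2 x, action_at next (O (hard_fun p (instance i))) t = Output x
              & eps_minimum eps (hard_fun p (instance i)) x >] ].

Lemma hard_answer (x : lp_ball n p) (s s' : inst) e0 :
  (forall e, (level e < level e0)%N -> s e = s' e) -> s e0 = s' e0 ->
  tolerance R k (level e0) <= dist p (val x) e0 s ->
  (forall e, level e = level e0 ->
     [/\ dist p (val x) e s <= dist p (val x) e0 s,
      dist p (val x) e s' <= dist p (val x) e0 s' &
      s e = s' e \/ (dist p (val x) e s < dist p (val x) e0 s /\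
                     dist p (val x) e s' < dist p (val x) e0 s')]) ->
  O (hard_fun p s) x = O (hard_fun p s') x.
Proof.
move=> H1 H2 H3 H4.
have inF (s2 : inst) : fam_instances hard_family (hard_fun p s2).
  exists (cast_ord (esym (prednK card_inst_gt0)) (enum_rank s2)).
  exists [tuple]; split; first by case.
  by rewrite /hard_family/= /instance cast_ordKV enum_rankK.
apply: O_local => //.
by apply: filterS (hard_fun_near H1 H2 H3 H4) => y ->.
Qed.

Lemma card_solved_by t :
  #|solved_by t|%:R <= 8 ^+ t * 2^-1 ^+ (L * m) * (#|{: inst}|.-1.+1)%:R :> R.
Proof.
have m0 : 0 < (m%:R : R) by rewrite ltr0n expn_gt0.
pose J0 : cell -> {set 'I_q} := fun=> [set: 'I_q]%SET.
pose ans (s : inst) := O (hard_fun p s).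
pose good (s : inst) := @eps_minimum R n p eps (hard_fun p s).
have cnt : #|solved next ans good t [::] :&: cyl J0|%:R
    <= (2 / 4^-1) ^+ t * weight (4 * m)%:R 4^-1 J0 [set: cell]%SET :> R.
  apply: (@count_solved R cell 'I_q (@level k L) L m _ A next ans good
    (4 * m)%:R 4^-1 (fun x => dist p (val x)) (tolerance R k)).
  - by move=> e; exact: ltn_ord.
  - move=> r; rewrite -[leqRHS](card_ord m).
    rewrite -(@card_in_imset _ _ (fun e : cell => e.2)) ?max_card// => e e'.
    rewrite !inE => /eqP <- /eqP/val_inj; move: e e' => [r1 i1] [r2 i2] /= -> ->.
    by [].
  - by rewrite natrM mulr_gt0.
  - by rewrite invr_gt0.
  - by rewrite -[leRHS]invrK lef_pV2 ?posrE//; lra.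
  - exact: tie_factor.
  - by move=> x e s s'; exact: dist_dep.
  - by move=> x e s v; exact: dist_ties.
  - by move=> x e s; exact: dist_small.
  - exact: hard_answer.
  - by move=> x s e; exact: eps_minimum_dist.
  - by move=> e; rewrite inE.
apply: le_trans (_ : #|solved next ans good t [::] :&: cyl J0|%:R <= _).
  rewrite ler_nat -(card_imset _ instance_inj); apply: subset_leq_card.
  apply/fintype.subsetP => _ /imsetP[i + ->]; rewrite inE => /asboolP[x ix xmin].
  rewrite finset.in_setI; apply/andP; split; last first.
    by apply/cylP => e; rewrite inE.
  rewrite inE; apply/asboolP.
  exact: (@solves_output R n p A cell 'I_q next ans good _ _ x).
apply: le_trans cnt _; rewrite invrK -natrM -mulrA ler_wpM2l ?exprn_ge0//.
rewrite (prednK card_inst_gt0) card_inst natrX -exprMn /weight.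
(* A cell with all letters possible has weight 4 m + 16 m / 4 = 8 m, half the number of its
   letters. *)
rewrite (eq_bigr (fun=> 2^-1 * (16 * m)%:R)); last first.
  by move=> e _; rewrite cardsT card_ord !natrM; lra.
by rewrite prodr_const cardsT card_prod !card_ord.
Qed.
End hard_instances.

Local Open Scope classical_set_scope.
Local Open Scope ring_scope.

(** * From counting to probabilities *)

Section uniform_law.
Variables (R : realType) (N : nat).
Variables (d : measure_display) (Omega : measurableType d) (P : probability Omega R).

Lemma uniform_ordE (Y : set 'I_N.+1) :
  uniform_ord R N Y = (#|[set i | `[< Y i >]]%SET|%:R / N.+1%:R)%:E.
Proof.
rewrite /uniform_ord /mscale /= /msum.
under eq_bigr do rewrite /= diracE.
have E (i : 'I_N.+1) : inord i = i :> 'I_N.+1 by rewrite inord_val.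
under eq_bigr do rewrite E.
rewrite sumEFin -EFinM mulrC; congr (_ / _)%:E.
rewrite -sum1_card natr_sum [RHS]big_mkcond/=; apply: eq_bigr => i _.
rewrite [in RHS]inE (_ : (i \in Y) = `[< Y i >]); first by case: `[< _ >].
by apply/idP/asboolP; rewrite inE.
Qed.

(** Fubini: integrating over the randomness last, a count for each fixed [w] suffices, as the box
    without sides is a single point. *)
Lemma law_le (X : set ('I_N.+1 * (size (@nil (side R))).-tuple R * Omega)) (c : R) :
  measurable X ->
  (forall w, #|[set i | `[< X ((i, [tuple]), w) >]]%SET|%:R <= c * N.+1%:R) ->
  (((uniform_ord R N \x uniform_box [::]) \x P) X <= c%:E)%E.
Proof.
move=> mX Xc.
pose B : probability ((size (@nil (side R))).-tuple R) R := uniform_box [::].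
pose U : probability ('I_N.+1 * (size (@nil (side R))).-tuple R)%type R :=
  (uniform_ord R N \x B)%E.
rewrite -[X in (X <= _)%E]/((U \x P)%E X).
have UE Y : measurable Y ->
    U Y = (#|[set i | `[< Y (i, [tuple]) >]]%SET|%:R / N.+1%:R)%:E.
  move=> mY; pose Z : set 'I_N.+1 := [set i | Y (i, [tuple])].
  have YZ : Y = Z `*` setT.
    apply/seteqP; split=> [[i u]|[i u]] /=; rewrite (tuple0 u)//.
    by case.
  rewrite [in LHS]YZ.
  have -> : U (Z `*` setT) = (uniform_ord R N Z * B setT)%E.
    exact: product_measure1E.
  by rewrite [B setT]probability_setT mule1 uniform_ordE.
rewrite (_ : (U \x P)%E X = (U \x^ P)%E X); last first.
  apply: (@product_measure_unique _ _ _ _ R U P (U \x^ P)%E) => //.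
  by move=> Y Z mY mZ; exact: (product_measure2E U P mY mZ).
rewrite /product_measure2.
apply: (@le_trans _ _ (\int[P]_w cst c%:E w)%E); last first.
  have P1 := probability_setT P.
  by rewrite integral_cst// [X in (_ * X)%E]P1 mule1.
apply: ge0_le_integral => //.
- exact: measurable_fun_ysection.
- move=> w _ /=; rewrite UE; last exact: measurable_ysection.
  rewrite lee_fin ler_pdivrMr//.
  apply: le_trans (Xc w); rewrite ler_nat; apply: subset_leq_card.
  apply/fintype.subsetP => i; rewrite !inE => /asboolP.
  by rewrite /ysection/= => Xi; apply/asboolP; move: Xi; rewrite inE.
Qed.
End uniform_law.

Section measurable_hard.
Variables (R : realType) (n k L : nat) (p : R).
Variables (d : measure_display) (T : measurableType d).

Lemma measurable_hard_fun (s : {ffun 'I_L * 'I_(2 ^ k) -> 'I_(16 * 2 ^ k)})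
    (f : T -> 'rV[R]_n) :
  (forall i, measurable_fun setT (fun z => f z ord0 i)) ->
  measurable_fun setT (fun z => hard_fun p s (f z)).
Proof.
move=> mf; rewrite /hard_fun; elim: index_enum => [|e r IHr].
  by under eq_fun do rewrite big_nil; exact: measurable_cst.
under eq_fun do rewrite big_cons.
apply: measurable_maxr => //; apply: measurable_funM; first exact: measurable_cst.
apply: measurable_funB; last exact: measurable_cst.
apply: measurableT_comp; first exact: normr_measurable.
apply: measurable_funB; last exact: measurable_cst.
apply: measurable_funM; first exact: measurable_cst.
rewrite (_ : (fun z => _) = (fun z => \sum_(j < n)
    if (j < 2 ^ k)%N then hadamard R k e.2 j * f z ord0 j else 0)); last first.
  by apply/funext => z; rewrite big_mkcond.
apply: measurable_sum => j; case: (j < 2 ^ k)%N; last exact: measurable_cst.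
by apply: measurable_funM => //; exact: measurable_cst.
Qed.
End measurable_hard.

(** * Querying and succeeding at a given step *)

Section hard_runs.
Variables (R : realType) (n k L : nat) (p : R).
Hypotheses (p_ge1 : 1 <= p) (p_lt2 : p < 2) (mn : (2 ^ k <= n)%N).
Local Notation m := (2 ^ k)%N.
Local Notation F := (hard_family n k L p_ge1).
Variable eps : R.
Hypothesis eps_small : forall r, (r < L)%N -> eps <= slope R r * (tolerance R k r / 2).
Variables (A : Type) (O : oracle n p A) (O_local : local_oracle F O).
Variables (d : measure_display) (Omega : measurableType d) (P : probability Omega R).
Variables (alg : algorithm n p A Omega) (alg_meas : measurable_run F O alg).

Local Notation sample :=
  ('I_(fam_card F).+1 * (size (fam_sides F)).-tuple R * Omega)%type.

Lemma samplesT : @samples _ _ _ F _ Omega = setT.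
Proof. by apply/seteqP; split=> // z _ []. Qed.

Definition querying t : set sample := [set z : sample | is_query (run_action O alg z t)].

Definition succeeding t : set sample :=
  [set z : sample | ~~ is_query (run_action O alg z t) /\
    eps_minimum eps (fam_fun F z.1.1 z.1.2) (point_of (run_action O alg z t))].

Lemma measurable_querying t : measurable (querying t).
Proof.
have [mq _] := alg_meas t; rewrite samplesT in mq.
by have := mq measurableT [set true] I; rewrite setTI.
Qed.

(** The event is split over the finitely many instances; for a fixed one, [hard_fun] at the random
    point is compared with a constant. *)
Lemma measurable_succeeding t : measurable (succeeding t).
Proof.
have [mq mx] := alg_meas t; rewrite samplesT in mq mx.
have -> : succeeding t = ~` querying t `&`
    \bigcup_(i in [set: 'I_(fam_card F).+1])
     ([set z : sample | z.1.1 = i] `&`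
      [set z | hard_fun p (instance i) (val (point_of (run_action O alg z t))) <
        inf (hard_fun p (instance i) @` lp_ball n p) + eps]).
  apply/seteqP; split=> [z [nq mz]|z [nq [i _ [/= zi iz]]]].
    by split; [exact/negP|exists z.1.1].
  by split; [exact/negP|rewrite /eps_minimum zi].
apply: measurableI; first by apply: measurableC; exact: measurable_querying.
apply: fin_bigcup_measurable => [|i _]; first exact: finite_finset.
apply: measurableI.
  have m11 : measurable_fun [set: sample] (fun z => z.1.1).
    exact: measurableT_comp measurable_fst measurable_fst.
  by have := m11 measurableT [set i] I; rewrite setTI.
have mh : measurable_fun [set: sample]
    (fun z => hard_fun p (instance i) (val (point_of (run_action O alg z t)))).
  exact: measurable_hard_fun.
have := measurable_fun_ltr mh (measurable_cst
  (inf (hard_fun p (instance i) @` lp_ball n p) + eps)).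
by move=> /(_ measurableT [set true] I); rewrite setTI.
Qed.

Lemma succeedingE :
  [set z : sample | exists2 x, outputs (alg z.2) (O (fam_fun F z.1.1 z.1.2)) x
      & eps_minimum eps (fam_fun F z.1.1 z.1.2) x] = \bigcup_t succeeding t.
Proof.
apply/seteqP; split=> [z [x [t tx] xmin]|z [t _ [+ xmin]]].
  by exists t => //; split; rewrite /run_action tx.
rewrite /run_action; case E: (action_at _ _ _) xmin => [//|x] xmin _.
by exists x; [exists t|move: xmin; rewrite /run_action E].
Qed.

Lemma success_probE : success_prob F O P alg eps = law F P (\bigcup_t succeeding t).
Proof. by rewrite /success_prob samplesT setTI succeedingE. Qed.

Lemma law_succeeding t :
  (law F P (succeeding t) <= (8 ^+ t * 2^-1 ^+ (L * m))%:E)%E.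
Proof.
apply: law_le => [|w]; first exact: measurable_succeeding.
have H := card_solved_by p_lt2 mn eps_small O_local (alg w) t.
apply: le_trans H.
rewrite ler_nat; apply: subset_leq_card; apply/fintype.subsetP => i.
rewrite inE => /asboolP[/= + +]; rewrite /run_action/= => nq xmin.
rewrite inE; apply/asboolP; move: nq xmin.
by case E: (action_at _ _ _) => [//|x] _ xmin; exists x.
Qed.

(** A successful run either still queries at step [t] or has already produced its output; the latter
    has probability at most [eta]. *)
Lemma law_querying t Pe eta :
  8 ^+ t * 2^-1 ^+ (L * m) <= eta ->
  ((1 - Pe)%:E <= success_prob F O P alg eps)%E ->
  ((1 - Pe - eta)%:E <= law F P (querying t))%E.
Proof.
move=> le_eta; rewrite success_probE => le_succ.
rewrite EFinB leeBlDr//; apply: le_trans le_succ _.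
have sub : \bigcup_t succeeding t `<=` querying t `|` succeeding t.
  move=> z [t' _ [+ xmin]]; have [q|nq] := boolP (is_query (run_action O alg z t)).
    by left.
  move: nq; rewrite /run_action.
  case E : (action_at _ _ t) => [//|x] _; case E' : (action_at _ _ t') => [//|x'] _.
  right; split; rewrite /run_action E//=.
  by move: xmin; rewrite /run_action E'/= (output_unique E E').
have mS : measurable (\bigcup_t succeeding t).
  by apply: bigcupT_measurable => t'; exact: measurable_succeeding.
have mQ := measurable_querying t; have mSt := measurable_succeeding t.
apply: (@le_trans _ _ (law F P (querying t `|` succeeding t))).
  by apply: le_measure; rewrite ?inE//; exact: measurableU.
apply: le_trans (measureU2 _ mQ mSt) _.
by rewrite leeD2l// (le_trans (law_succeeding t))// lee_fin.
Qed.

Lemma measurable_run_queries : measurable_fun [set: sample] (run_queries O alg).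
Proof.
apply: ge0_emeasurable_sum => [t z _ _|t _]; first by rewrite lee_fin.
apply/measurable_EFinP.
rewrite (_ : (fun z => _) = \1_(querying t)).
  by apply: measurable_indic; exact: measurable_querying.
apply/funext => z; rewrite indicE; congr (nat_of_bool _)%:R.
by apply/idP/idP; rewrite inE.
Qed.

Lemma prob_queries_ge_querying t r : r <= t.+1%:R ->
  (law F P (querying t) <= prob_queries_ge F O P alg r)%E.
Proof.
move=> rt; rewrite /prob_queries_ge samplesT setTI.
apply: le_measure; rewrite ?inE; first exact: measurable_querying.
  have := measurable_lee measurableT (measurable_cst (r%:E : \bar R))
    measurable_run_queries.
  by rewrite setTI.
move=> z qz; have : ((t.+1%:R)%:E <= run_queries O alg z)%E.
  exact: queries_gt.
apply: le_trans.
by rewrite lee_fin.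
Qed.

(** Markov's inequality: the runs in [querying t] make at least [t.+1] queries. *)
Lemma expected_queries_querying t :
  ((t.+1%:R)%:E * law F P (querying t) <= expected_queries F O P alg)%E.
Proof.
rewrite /expected_queries samplesT.
have mQ := measurable_querying t.
apply: (@le_trans _ _
  (\int[law F P]_(z in querying t) run_queries O alg z)%E); last first.
  apply: ge0_subset_integral => //; first exact: measurable_run_queries.
  by move=> z _; apply: nneseries_ge0 => i _ _; rewrite lee_fin.
rewrite -integral_cst//; apply: ge0_le_integral => //.
- by move=> z _; rewrite lee_fin.
- by apply: measurable_funTS; exact: measurable_run_queries.
- by move=> z qz; exact: queries_gt.
Qed.
End hard_runs.

(** * Number of levels and asymptotic estimates *)

Section asymptotics.
Variables (R : realType).

(** Slope times tolerance falls by 4 * 64 = 2^8 per level, from the order of n^(-1/2); each level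
    thus uses 8 bits of precision. *)
Definition depth (n : nat) (eps : R) : nat :=
  Num.truncn (log2 (eps * Num.sqrt n%:R)^-1 / 8).

Lemma ln2_gt0 : 0 < ln (2 : R).
Proof. by rewrite ln_gt0// ltr1n. Qed.

Lemma log2_half_scale (n : nat) (eps : R) : 0 < eps -> (0 < n)%N ->
  log2 (eps * Num.sqrt n%:R)^-1 = log2 eps^-1 - log2 n%:R / 2.
Proof.
move=> eps0 n0; have s0 : 0 < Num.sqrt (n%:R : R) by rewrite sqrtr_gt0 ltr0n.
rewrite /log2 !lnV ?posrE ?mulr_gt0// lnM ?posrE//.
have -> : ln (n%:R : R) = ln (Num.sqrt n%:R) *+ 2.
  by rewrite -lnXn// sqr_sqrtr.
by rewrite mulr2n; field; rewrite gt_eqF ?ln2_gt0.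
Qed.

Lemma depth_small (n : nat) (eps : R) r : 0 < eps -> (0 < n)%N ->
  (r < depth n eps)%N ->
  eps <= slope R r * (tolerance R (trunc_log 2 n) r / 2).
Proof.
move=> eps0 n0; rewrite /depth truncn_gt_nat ler_pdivlMr// ler_pdivlMr ?ln2_gt0//.
have s0 : 0 < Num.sqrt (n%:R : R) by rewrite sqrtr_gt0 ltr0n.
have es0 : 0 < (eps * Num.sqrt n%:R)^-1 by rewrite invr_gt0 mulr_gt0.
have [b bE b0] : exists2 b : R, b = 256 & 0 < b.
  by exists 256; [exact: erefl|rewrite ltr0n].
have -> : r.+1%:R * 8 * ln 2 = ln (b ^+ r.+1).
  rewrite bE (_ : 256 = 2 ^+ 8); last by rewrite -natrX.
  by rewrite -exprM lnXn// -[RHS]mulr_natl natrM; ring.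
have pb i : 0 < b ^+ i by rewrite exprn_gt0.
rewrite ler_ln ?posrE// => le256.
set m := (2 ^ trunc_log 2 n)%N.
have m0 : 0 < (m%:R : R) by rewrite ltr0n expn_gt0.
have sm0 : 0 < Num.sqrt (m%:R : R) by rewrite sqrtr_gt0.
have mn : Num.sqrt (m%:R : R) <= Num.sqrt n%:R.
  by rewrite ler_wsqrtr// ler_nat trunc_logP.
have -> : slope R r * (tolerance R (trunc_log 2 n) r / 2) =
    (64 * Num.sqrt m%:R * b ^+ r)^-1.
  rewrite /slope /tolerance /step -/m bE (_ : 256 = 4 * 64); last first.
    by rewrite -natrM.
  by rewrite exprMn; field; rewrite !expf_neq0 ?gt_eqF.
rewrite -[eps]invrK lef_pV2 ?posrE ?invr_gt0 ?mulr_gt0//.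
move: le256; rewrite invfM ler_pdivlMr// exprS => /(le_trans _); apply.
rewrite [leRHS]mulrAC ler_wpM2r ?(ltW (pb _))//.
by apply: ler_pM; rewrite ?ler0n ?(ltW sm0)// bE ler_nat.
Qed.

(** The bound on [eps] makes log n / 2 at most the fraction 1 / (1 + 2 delta) of log(1/eps), so the
    remaining [x] is at least 2 delta / (1 + 2 delta) of it. As [x >= 16], truncating [x / 8] loses
    at most half. *)
Lemma depth_large (n : nat) (eps delta : R) : 0 < eps -> (0 < n)%N -> 0 < delta ->
  16 <= delta * log2 n%:R -> eps <= n%:R `^ (- 2^-1 - delta) ->
  [/\ (0 < depth n eps)%N, 0 < log2 eps^-1 &
   delta / (1 + 2 * delta) * log2 eps^-1 <= 8 * (depth n eps)%:R].
Proof.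
move=> eps0 n0 delta0 n_large eps_le.
have l2 := ln2_gt0.
have d0 : 0 < 1 + 2 * delta by lra.
have Lam : (2^-1 + delta) * log2 n%:R <= log2 eps^-1.
  rewrite /log2 mulrA ler_pM2r ?invr_gt0// lnV ?posrE//.
  have : ln eps <= ln (n%:R `^ (- 2^-1 - delta)).
    by rewrite ler_ln ?posrE ?powR_gt0 ?ltr0n.
  by rewrite ln_powR; lra.
have ln0 : 0 < log2 (n%:R : R).
  by rewrite -(pmulr_rgt0 _ delta0); apply: lt_le_trans n_large.
have Lam0 : 0 < log2 eps^-1 by apply: lt_le_trans Lam; rewrite mulr_gt0//; lra.
have := log2_half_scale eps0 n0; set x := log2 (eps * _)^-1 => xE.
have x16 : 16 <= x by rewrite xE; lra.
have x_ge : 2 * delta / (1 + 2 * delta) * log2 eps^-1 <= x.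
  rewrite mulrAC ler_pdivrMr// xE; nra.
have L_gt : x / 8 < (depth n eps)%:R + 1 by rewrite natr1; exact: truncnS_gt.
have L1 : (1 : R) <= (depth n eps)%:R.
  by rewrite ler1n /depth truncn_gt0 -/x ler_pdivlMr//; lra.
split=> //; first by rewrite -(ltr_nat R); lra.
have -> : delta / (1 + 2 * delta) * log2 eps^-1 =
  2 * delta / (1 + 2 * delta) * log2 eps^-1 / 2.
  by field; rewrite gt_eqF.
have concl (u v w : R) : u <= v -> v / 8 < w + 1 -> 16 <= v -> u / 2 <= 8 * w.
  by move=> *; lra.
exact: concl x_ge L_gt x16.
Qed.

(** Squaring avoids halved exponents: the square is at most 2^(-L m) <= 2^(-m), and 1/2 <= (9/10)^4
    with [n <= 2 * m] concludes. *)
Lemma failure_bound (m n t L : nat) : (n <= 2 * m)%N -> (0 < L)%N ->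
  (6 * t <= L * m)%N -> 8 ^+ t * 2^-1 ^+ (L * m) <= (9 / 10 : R) ^+ n.
Proof.
move=> nm L0 tL.
have half0 : 0 <= 2^-1 :> R by rewrite invr_ge0.
have half1 : 2^-1 <= 1 :> R by rewrite invf_le1// ler1n.
have n0 : 0 <= 9 / 10 :> R by rewrite divr_ge0.
have n1 : 9 / 10 <= 1 :> R by rewrite ler_pdivrMr// mul1r ler_nat.
rewrite -ler_sqr ?nnegrE ?mulr_ge0 ?exprn_ge0// exprMn -!exprM.
apply: (@le_trans _ _ (2^-1 ^+ (L * m))).
  apply: (@le_trans _ _ (2 ^+ (L * m) * 2^-1 ^+ (L * m * 2))).
    rewrite ler_wpM2r ?exprn_ge0//.
    rewrite (_ : 8 = 2 ^+ 3); last by rewrite -natrX.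
    rewrite -exprM ler_weXn2l ?ler1n//.
    by rewrite (mulnC t) mulnA; exact: tL.
  by rewrite muln2 -addnn exprD mulrA -exprMn mulfV// expr1n mul1r.
apply: (@le_trans _ _ (2^-1 ^+ m)).
  by rewrite ler_wiXn2l// leq_pmull.
apply: (@le_trans _ _ ((9 / 10) ^+ (4 * m))).
  rewrite exprM lerXn2r ?nnegrE ?exprn_ge0//.
  rewrite !exprS expr0; lra.
by rewrite ler_wiXn2l// mulnC; move: nm; rewrite -(leq_pmul2l (isT : 0 < 2)%N) mulnA.
Qed.

End asymptotics.

Theorem mainTheorem9 (R : realType) (p : R) (p_ge1 : 1 <= p) (p_lt2 : p < 2) :
  exists F : forall n : nat, R -> convex_family n p,
  forall delta : R, 0 < delta ->
  exists2 c : R, 0 < c &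
  forall Pe : R, 0 <= Pe -> Pe < 1 ->
  exists2 eta : nat -> R, eta @ \oo --> 0 &
  \forall n \near \oo, forall eps : R,
    0 < eps -> eps <= n%:R `^ (- 2^-1 - delta) ->
  forall (A : Type) (O : oracle n p A), local_oracle (F n eps) O ->
  forall (d : measure_display) (Omega : measurableType d)
    (P : probability Omega R) (alg : algorithm n p A Omega),
    measurable_run (F n eps) O alg ->
    ((1 - Pe)%:E <= success_prob (F n eps) O P alg eps)%E ->
    ((c * (1 - Pe) * n%:R * log2 eps^-1)%:E
       <= expected_queries (F n eps) O P alg)%E /\
    ((1 - Pe - eta n)%:E
       <= prob_queries_ge (F n eps) O P alg (c * n%:R * log2 eps^-1))%E.
Proof.
exists (fun n eps => hard_family n (trunc_log 2 n) (depth n eps) p_ge1).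
have half_compl (u : R) : u / 2 <= u - u / 2 by lra.
move=> delta delta0; have l2 := ln2_gt0 R.
(* 96 = 6 * 16: the 6 is from [6 * t <= L * m], the 16 from [8 * L] in [depth_large] and n <= 2
   m. *)
pose c0 := delta / (1 + 2 * delta) / 96.
have d0 : 0 < 1 + 2 * delta by lra.
have c00 : 0 < c0 by rewrite !divr_gt0.
(* Halving [c0] absorbs the failure probability in the expectation, since it is below [(1 - Pe) / 2]
   for large [n]. *)
exists (c0 / 2) => [|Pe Pe0 Pe1]; first by rewrite divr_gt0.
have eta0 : (fun n => (9 / 10 : R) ^+ n) @ \oo --> 0.
  by apply: cvg_expr; rewrite ger0_norm ?divr_ge0// ltr_pdivrMr// mul1r ltr_nat.
exists (fun n => (9 / 10) ^+ n) => //.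
near=> n => eps eps_gt0 eps_le A O O_local d Omega P alg alg_meas succ.
(* The left side is 2^(16 / delta), so this is the condition on [n] of [depth_large].

   @ DONE *)
have n_large : expR (16 / delta * ln 2) <= n%:R by near: n; exact: nbhs_infty_ger.
have eta_small : (9 / 10 : R) ^+ n < (1 - Pe) / 2.
  by near: n; apply: (cvgr_lt _ eta0); lra.
have n0 : (0 < n)%N.
  by rewrite -(ltr_nat R); apply: lt_le_trans n_large; exact: expR_gt0.
have log_large : 16 <= delta * log2 n%:R.
  rewrite mulrC -ler_pdivrMr// /log2 ler_pdivlMr// -ler_expR lnK// posrE ltr0n//.
have [L0 Lam0 L_ge] := depth_large eps_gt0 n0 delta0 log_large eps_le.
set k := trunc_log 2 n in succ alg_meas O_local *.
set L := depth n eps in succ alg_meas O_local L0 L_ge *.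
have mn : (2 ^ k <= n)%N by exact: trunc_logP.
have nm : (n < 2 * 2 ^ k)%N by rewrite -expnS; exact: trunc_log_ltn.
pose r := c0 * n%:R * log2 eps^-1.
have r0 : 0 < r by rewrite /r mulr_gt0// mulr_gt0// ltr0n.
pose t := Num.truncn r.
have /andP[t_le t_gt] : t%:R <= r < t.+1%:R by apply: truncn_itv; exact: ltW.
have tL : (6 * t <= L * 2 ^ k)%N.
  rewrite -(ler_nat R) !natrM; apply: (@le_trans _ _ (6 * r)).
    by rewrite ler_wpM2l.
  have nm' : n%:R <= 2 * (2 ^ k)%:R :> R by rewrite -natrM ler_nat ltnW.
  have -> : 6 * r = (delta / (1 + 2 * delta) * log2 eps^-1) * (n%:R / 16).
    by rewrite /r /c0; field; rewrite gt_eqF.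
  apply: (@le_trans _ _ (8 * L%:R * (n%:R / 16))).
    by rewrite ler_wpM2r// divr_ge0.
  have : L%:R * n%:R <= L%:R * (2 * (2 ^ k)%:R) :> R by rewrite ler_wpM2l.
  lra.
have le_eta := failure_bound R (ltnW nm) L0 tL.
have small r' : (r' < L)%N -> eps <= slope R r' * (tolerance R k r' / 2).
  exact: depth_small.
have Q := law_querying p_lt2 mn small O_local alg_meas le_eta succ.
split; last first.
  apply: le_trans Q _; apply: prob_queries_ge_querying => //.
  apply: le_trans (ltW t_gt); rewrite -/r.
  have -> : c0 / 2 * n%:R * log2 eps^-1 = r / 2 by rewrite /r; ring.
  by rewrite ler_pdivrMr// ler_peMr ?ler1n// ltW.
apply: le_trans (expected_queries_querying _ alg_meas t).
apply: (@le_trans _ _ ((t.+1%:R)%:E * (1 - Pe - (9 / 10) ^+ n)%:E)%E).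
  rewrite -EFinM lee_fin.
  have -> : c0 / 2 * (1 - Pe) * n%:R * log2 eps^-1 = r * ((1 - Pe) / 2).
    by rewrite /r; ring.
  apply: ler_pM; rewrite ?(ltW r0) ?(ltW t_gt)//.
    by rewrite divr_ge0// subr_ge0 ltW.
  by rewrite lerBrDl -lerBrDr (le_trans (ltW eta_small))// half_compl.
by rewrite lee_wpmul2l// lee_fin.
Unshelve. all: by end_near. Qed.
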